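(* Let $T>0$ and let $\pi\in D([0,T],\mathcal M)$, $\pi(t,dx)=u(t,x)dx$, be such that $I_{[0,T]}(\pi)<+\infty$. Then, for each $g\in C^1([-1,1])$, there exists $P\in L^1([0,T])$ such that $$H_T\langle\pi_T,g\rangle-H_0\langle\pi_0,g\rangle-\int_0^TH'_t\,\langle\pi_t,g\rangle\,dt=\int_0^TH_t\,P_t\,dt$$ for all $H\in C^1([0,T])$.
   Context: Fix $a>-1/2$ and $\mathfrak a,\mathfrak b\in(0,1)$, with (without loss of generality) $\mathfrak a\le\mathfrak b$. Let $\Omega=]-1,1[$ and let $\mathcal M$ be the set of non-negative measures on $\Omega$ with total mass bounded by $2$, with the weak topology; $\langle\pi,F\rangle=\int_\Omega F\,d\pi$, and $\langle\cdot,\cdot\rangle$ also denotes the $L^2(\Omega)$ scalar product. $D([0,T],\mathcal M)$ is the space of right-continuous functions with left limits, with the Skorohod topology. $\nabla$ is the derivative in $x$. Rate function. Set $D(\rho)=1+2a\rho$, $\chi(\rho)=\rho(1-\rho)$, $\sigma(\rho)=\chi(\rho)D(\rho)$. Let $\mathcal M^0$ be the set of $\pi\in\mathcal M$ of the form $\pi(dx)=\gamma(x)dx$ with $0\le\gamma\le1$ a.e. For $\pi\in D([0,T],\mathcal M^0)$ write $\pi(t,dx)=u(t,x)dx$, $u_t=u(t,\cdot)$, and define the energy $$\mathcal Q(\pi)=\sup_G\Big\{2\int_0^T\langle u_t,\nabla G_t\rangle dt-\int_0^T\int_{-1}^1\chi(u(t,x))G(t,x)^2dx\,dt\Big\},$$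 the supremum being over $G\in C^{1,2}([0,T]\times[-1,1])$ ($C^1$ in time, $C^2$ in space) with compact support in $[0,T]\times]-1,1[$. Let $D_{\mathcal E}([0,T],\mathcal M^0)$ be the paths in $D([0,T],\mathcal M^0)$ with finite energy; for these $u\in L^2([0,T],\mathcal H^1(\Omega))$, $\nabla u$ is the weak derivative and $u_t(\pm1)$ are the boundary values of the continuous version of $u_t$. For $H\in C^{1,1}([0,T]\times[-1,1])$ and $\pi\in D_{\mathcal E}([0,T],\mathcal M^0)$ set $$J_H(\pi)=\langle\pi_T,H_T\rangle-\langle\pi_0,H_0\rangle-\int_0^T\langle\pi_t,\partial_tH_t\rangle dt+\int_0^T\!\!\int_{-1}^1D(u)\nabla u\nabla H\,dx\,dt-\int_0^T\!\!\int_{-1}^1\sigma(u)(\nabla H)^2dx\,dt-\int_0^TB(u_t,H_t)dt,$$ where $$B(u_t,H_t)=u_t(1)(1-\mathfrak b)(e^{-H(t,1)}-1)+\mathfrak b[1-u_t(1)](e^{H(t,1)}-1)+u_t(-1)(1-\mathfrak a)(e^{-H(t,-1)}-1)+\mathfrak a[1-u_t(-1)](e^{H(t,-1)}-1).$$ For all other $\pi\in D([0,T],\mathcal M)$ set $J_H(\pi)=+\infty$. Then $I_{[0,T]}(\pi)=\sup_{H\in C^{1,1}([0,T]\times[-1,1])}J_H(\pi)$. *)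

(* Defs.v *)
From HB Require Import structures.
From mathcomp Require Import all_boot all_order all_algebra.
From mathcomp Require Import all_classical all_reals all_analysis.

Set Implicit Arguments.
Unset Strict Implicit.
Unset Printing Implicit Defensive.

Import Order.TTheory GRing.Theory Num.Theory.
Import numFieldNormedType.Exports.

Local Open Scope classical_set_scope.
Local Open Scope ring_scope.

Section Defs.
Context {R : realType}.

Local Notation leb := (@lebesgue_measure R).
Local Notation meas := {measure set (measurableTypeR R) -> \bar R}.

Implicit Types (f g u : R -> R) (G H : R -> R -> R).

Definition Omega : set R := `]-1, 1[.

(* A measure on Omega is represented by a Borel measure on R which does not
   charge the complement of Omega. *)
Definition Mset : set meas :=
  [set mu | mu (~` Omega) = 0%E /\ (mu Omega <= 2%:E)%E].

Definition pairing (mu : meas) f : R := \int[mu]_(x in Omega) f x.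

(* [mu_] converges to [nu] along the filter [F] for the weak topology, i.e. the
   coarsest one making [pairing ^~ f] continuous for every bounded continuous
   f : Omega -> R. *)
Definition weakly_cvg (I : Type) (mu_ : I -> meas) (F : set_system I)
    (nu : meas) : Prop :=
  forall f, {within Omega, continuous f} ->
    (exists K : R, forall x, Omega x -> `|f x| <= K) ->
    (fun i => pairing (mu_ i) f) @ F --> pairing nu f.

(* D([0,T], S); the values of a path outside [0,T] are irrelevant. *)
Definition cadlag (T : R) (S : set meas) : set (R -> meas) :=
  [set pi_ | [/\ forall t, t \in `[0, T] -> S (pi_ t),
     forall t, t \in `[0, T[ -> weakly_cvg pi_ (at_right t) (pi_ t) &
     forall t, t \in `]0, T] ->
       exists2 nu, S nu & weakly_cvg pi_ (at_left t) nu]].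

Definition is_density (mu : meas) g : Prop :=
  [/\ measurable_fun Omega g,
      (\forall x \ae leb, Omega x -> 0 <= g x <= 1) &
      forall A : set R, measurable A ->
        mu A = (\int[leb]_(x in A `&` Omega) (g x)%:E)%E].

Definition M0set : set meas :=
  [set mu | Mset mu /\ exists g, is_density mu g].

(* Some version of the density; only used for measures in [M0set], and only
   through expressions that do not depend on the version. *)
Definition density (mu : meas) : R -> R :=
  xget (fun=> 0) [set g | is_density mu g].

Definition test_fun : set (R -> R) :=
  [set phi : R -> R | [/\ forall x : R, derivable phi x 1,
     continuous (derive1 phi),
     compact (closure [set x | phi x != 0]) &
     closure [set x | phi x != 0] `<=` Omega]].

(* [g], in L^2(Omega), is the weak derivative of [f]. *)
Definition is_weak_deriv f g : Prop :=
  [/\ measurable_fun Omega g,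
      leb.-integrable Omega (fun x => (g x ^+ 2)%:E) &
      forall phi, test_fun phi ->
        \int[leb]_(x in Omega) (f x * derive1 phi x) =
        - \int[leb]_(x in Omega) (g x * phi x)].

(* For f in H^1(Omega); the default value 0 is used otherwise. *)
Definition weak_deriv f : R -> R :=
  xget (fun=> 0) [set g | is_weak_deriv f g].

(* For f in H^1(Omega), the representative which is continuous on [-1,1]. *)
Definition cont_version f : R -> R :=
  xget (fun=> 0) [set v : R -> R | {within `[-1, 1], continuous v} /\
                          ae_eq leb Omega v f].

(* C^1 on a closed interval: C^1 in the interior, the function and its
   derivative having continuous extensions up to the boundary. *)
Definition C1 (a b : R) f : Prop :=
  [/\ {within `[a, b], continuous f},
      forall x, x \in `]a, b[ -> derivable f x 1 &
      exists2 h : R -> R, {within `[a, b], continuous h} &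
        forall x, x \in `]a, b[ -> derive1 f x = h x].

Definition rect (T : R) : set (R * R) := `[0, T] `*` `[-1, 1].
Definition rect_int (T : R) : set (R * R) := `]0, T[ `*` `]-1, 1[.

Definition dt G (t x : R) : R := derive1 (G ^~ x) t.
Definition dx G (t x : R) : R := derive1 (G t) x.

Definition ext_continuous (T : R) G : Prop :=
  exists2 h : R * R -> R, {within rect T, continuous h} &
    forall p, rect_int T p -> G p.1 p.2 = h p.

(* C^{1,1}([0,T] x [-1,1]) and C^{1,2}([0,T] x [-1,1]), with the same
   convention as [C1] at the boundary. *)
Definition C11 (T : R) : set (R -> R -> R) :=
  [set G | [/\ {within rect T, continuous (fun p => G p.1 p.2)},
     forall p, rect_int T p ->
       derivable (G ^~ p.2) p.1 1 /\ derivable (G p.1) p.2 1,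
     ext_continuous T (dt G) & ext_continuous T (dx G)]].

Definition C12 (T : R) : set (R -> R -> R) :=
  [set G | [/\ C11 T G,
     forall p, rect_int T p -> derivable (dx G p.1) p.2 1 &
     ext_continuous T (dx (dx G))]].

Definition supp (T : R) G : set (R * R) :=
  closure [set p | rect T p /\ G p.1 p.2 != 0].

Definition C12c (T : R) : set (R -> R -> R) :=
  [set G | [/\ C12 T G, compact (supp T G) &
               supp T G `<=` `[0, T] `*` Omega]].

Definition chi (r : R) : R := r * (1 - r).
Definition diffusivity (a r : R) : R := 1 + 2 * a * r.
Definition sigma (a r : R) : R := chi r * diffusivity a r.

Definition energy (T : R) (pi_ : R -> meas) : \bar R :=
  ereal_sup [set
    (2 * (\int[leb]_(t in `[0, T])
            \int[leb]_(x in Omega) (density (pi_ t) x * dx G t x))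
     - \int[leb]_(t in `[0, T])
         \int[leb]_(x in Omega) (chi (density (pi_ t) x) * G t x ^+ 2))%:E
    | G in C12c T].

Definition DE (T : R) : set (R -> meas) :=
  [set pi_ | cadlag T M0set pi_ /\ (energy T pi_ < +oo)%E].

(* (up, um) are the values of u_t, and (hp, hm) those of H_t, at (1, -1). *)
Definition B (fa fb up um hp hm : R) : R :=
  up * (1 - fb) * (expR (- hp) - 1) + fb * (1 - up) * (expR hp - 1)
  + um * (1 - fa) * (expR (- hm) - 1) + fa * (1 - um) * (expR hm - 1).

Definition J_formula (a fa fb T : R) H (pi_ : R -> meas) : R :=
  let u t := density (pi_ t) in
  pairing (pi_ T) (H T) - pairing (pi_ 0) (H 0)
  - (\int[leb]_(t in `[0, T]) pairing (pi_ t) (dt H t))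
  + (\int[leb]_(t in `[0, T]) \int[leb]_(x in Omega)
       (diffusivity a (u t x) * weak_deriv (u t) x * dx H t x))
  - (\int[leb]_(t in `[0, T]) \int[leb]_(x in Omega)
       (sigma a (u t x) * dx H t x ^+ 2))
  - (\int[leb]_(t in `[0, T])
       B fa fb (cont_version (u t) 1) (cont_version (u t) (-1))
         (H t 1) (H t (-1))).

Definition J (a fa fb T : R) H (pi_ : R -> meas) : \bar R :=
  if `[< DE T pi_ >] then (J_formula a fa fb T H pi_)%:E else +oo%E.

Definition rate (a fa fb T : R) (pi_ : R -> meas) : \bar R :=
  ereal_sup [set J a fa fb T H pi_ | H in C11 T].

End Defs.

(* Main.v *)
Require Import Defs.
From HB Require Import structures.
From mathcomp Require Import all_boot all_order all_algebra.
From mathcomp Require Import all_classical all_reals all_analysis.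
From mathcomp Require Import measurable_realfun ring lra.

Import Order.TTheory GRing.Theory Num.Theory.
Import numFieldNormedType.Exports.

Local Open Scope classical_set_scope.
Local Open Scope ring_scope.

Set Implicit Arguments.
Unset Strict Implicit.
Unset Printing Implicit Defensive.

(** Write F(t) for the pairing of pi_t with g.  The statement says that F is the
    primitive of an integrable function P, i.e. that P represents the linear
    functional ell(H) = H(T) F(T) - H(0) F(0) - int H' F on C^1([0,T]).

    Testing the rate function with G(t,x) = H(t) g(x) turns its finiteness into
    an upper bound on ell(H): if |H| <= M on [0,T] then
    ell(H) <= I + int |H| kappa_M for an integrable kappa_M.  Replacing H by
    l H with l large gives |ell(H)| <= e + int |H| k for |H| <= 1 and every
    e > 0, with k depending on e only, so ell tends to 0 along uniformly bounded
    sequences that tend to 0 almost everywhere.  Such a functional has a density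
    ([integral_representation]): every bounded measurable function is an almost
    everywhere limit of uniformly bounded C^1 functions ([C1_approximation]), so
    ell extends to bounded measurable functions; on indicators the extension is a
    finite signed measure which vanishes on null sets, and P is its
    Radon-Nikodym derivative.  No integration by parts for F is involved.

    To produce kappa_M one dominates the remaining terms of the rate function.
    The mobility and boundary terms are bounded because 0 <= u <= 1.  The
    gradient term is H(t) A(t) with A(t) = int D(u_t) w_t g' dx, where w_t is the
    weak derivative of u_t, and an integrable bound on A comes from the energy.
    Cut ]-1,1[ into n cells of length d and let phi_i be bumps supported in the
    cells.  Energy test functions sum_i H_i(t) phi_i(x), where the H_i approach
    the optimal choice <pi_t, phi_i'> / d, give
    int_0^T sum_i <pi_t, phi_i'>^2 / d dt <= Q
    ([discrete_energy_le]).  For a time t at which the weak derivative exists,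
    <pi_t, phi_i'> = - int w_t phi_i; letting the bumps grow to the indicators
    of the cells and the mesh go to 0, the lower limit of these sums dominates
    2 (|int w_t f| - C^2) for every f bounded by C ([weak_deriv_bound]), and
    f = D(u_t) g' bounds A(t).  By Fatou's lemma this lower limit is integrable
    in time ([relaxed_energy_dominated]).

    Expressions that are not linear in u_t are never shown to be measurable in
    t: the integral of an arbitrary function is a difference of two suprema over
    simple functions, hence it is bounded by the integral of any integrable
    function that dominates it almost everywhere ([normr_Rintegral_le_ae]). *)

(** * Integration without measurability *)

Section integral_bounds.
Context d (T : measurableType d) (R : realType) (mu : {measure set T -> \bar R}).
Implicit Types (D : set T) (f k : T -> R).

Import HBNNSimple.

(** The integral of a nonnegative function is a supremum over the simple functions
    below it, and each of these is measurable, so [f] itself may be arbitrary. *)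
Lemma le_ge0_integral_ae D (f k : T -> \bar R) : measurable D ->
    measurable_fun D k -> (forall x, D x -> (0 <= f x)%E) ->
    (forall x, D x -> (0 <= k x)%E) ->
    (\forall x \ae mu, D x -> (f x <= k x)%E) ->
  (\int[mu]_(x in D) f x <= \int[mu]_(x in D) k x)%E.
Proof.
move=> mD mk f0 k0 fk; rewrite ge0_integralE//.
apply: ge_ereal_sup => _ [h /= hf <-].
rewrite -integralT_nnsfun.
rewrite [leRHS]integral_mkcond.
apply: ae_ge0_le_integral => //.
- by move=> x _; rewrite lee_fin; exact: fun_ge0.
- exact/measurable_EFinP/measurable_funTS.
- by move=> x _; exact: erestrict_ge0.
- exact/(measurable_restrictT _ _).1.
apply: filterS fk => x fk _; apply: le_trans (hf x) _.
by rewrite !patchE; case: ifPn => // /set_mem xD; exact: fk.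
Qed.

(** Here [f] is arbitrary: this is how the terms of the rate function whose
    measurability in time is unclear are estimated. *)
Lemma normr_Rintegral_le_ae D f k : measurable D ->
    mu.-integrable D (EFin \o k) ->
    (\forall x \ae mu, D x -> `|f x| <= k x) ->
  `|\int[mu]_(x in D) f x| <= \int[mu]_(x in D) k x.
Proof.
move=> mD ik fk.
have /integrableP[mk _] := ik.
pose k' x := `|k x|.
have mk' : measurable_fun D (EFin \o k').
  by apply/measurable_EFinP/measurableT_comp => //; exact/measurable_EFinP.
have kk' : (\int[mu]_(x in D) (k x)%:E = \int[mu]_(x in D) (k' x)%:E)%E.
  apply: ae_eq_integral => //.
  apply: filterS fk => x fk Dx; congr EFin; rewrite /k' ger0_norm//.
  exact: le_trans (fk Dx).
have bnd (p : T -> \bar R) : (forall x, D x -> (0 <= p x <= `|f x|%:E)%E) ->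
    (0 <= \int[mu]_(x in D) p x <= \int[mu]_(x in D) (k x)%:E)%E.
  move=> pf; rewrite integral_ge0/=; last by move=> x Dx; have /andP[+ _] := pf x Dx; exact.
  rewrite kk'; apply: le_ge0_integral_ae => //.
    by move=> x Dx; have /andP[+ _] := pf x Dx; exact.
    by move=> x _; rewrite lee_fin /k' normr_ge0.
  apply: filterS fk => x fk Dx; have /andP[_ /le_trans] := pf _ Dx; apply.
  rewrite lee_fin (le_trans (fk Dx))//; exact: ler_norm.
have kfin := integrable_fin_num mD ik.
rewrite /Rintegral integralE.
have /andP[p0 pk] : (0 <= \int[mu]_(x in D) ((EFin \o f) ^\+ x) <= \int[mu]_(x in D) (k x)%:E)%E.
  apply: bnd => x Dx; rewrite funepos_ge0 /=.
  by rewrite funeposE ge_max/= lee_fin ler_norm lee_fin normr_ge0.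
have /andP[n0 nk] : (0 <= \int[mu]_(x in D) ((EFin \o f) ^\- x) <= \int[mu]_(x in D) (k x)%:E)%E.
  apply: bnd => x Dx; rewrite funeneg_ge0 /=.
  rewrite funenegE ge_max/= lee_fin lee_fin normr_ge0 andbT.
  by rewrite -normrN ler_norm.
have pfin : (\int[mu]_(x in D) ((EFin \o f) ^\+ x))%E \is a fin_num.
  by rewrite ge0_fin_numE// (le_lt_trans pk)// ltey_eq kfin.
have nfin : (\int[mu]_(x in D) ((EFin \o f) ^\- x))%E \is a fin_num.
  by rewrite ge0_fin_numE// (le_lt_trans nk)// ltey_eq kfin.
rewrite fineB//.
move: p0 pk n0 nk; rewrite -(fineK pfin) -(fineK nfin) -(fineK kfin) !lee_fin.
rewrite ler_norml; lra.
Qed.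

Lemma integrable_scale D k c : measurable D -> mu.-integrable D (EFin \o k) ->
  mu.-integrable D (EFin \o (fun t => c * k t)).
Proof. by move=> mD ik; exact: (integrableZl mD c ik). Qed.

Lemma Rintegral_sum D (I : Type) (s : seq I) (f : I -> T -> R) : measurable D ->
    (forall i, mu.-integrable D (EFin \o f i)) ->
  mu.-integrable D (EFin \o (fun t => \sum_(i <- s) f i t)) /\
  \int[mu]_(t in D) \sum_(i <- s) f i t = \sum_(i <- s) \int[mu]_(t in D) f i t.
Proof.
move=> mD fi; elim: s => [|i s [is_ IH]].
  have -> : (fun t => \sum_(i <- [::]) f i t) = (fun=> 0).
    by apply/funext => t; rewrite big_nil.
  by rewrite big_nil Rintegral_cst// mul0r; split => //; exact: integrable0.
have -> : (fun t => \sum_(j <- i :: s) f j t) = (fun t => f i t + \sum_(j <- s) f j t).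
  by apply/funext => t; rewrite big_cons.
split; first exact: (integrableD mD (fi i) is_).
by rewrite big_cons RintegralD// IH.
Qed.

Lemma Rdominated_cvg D (f_ : nat -> T -> R) f k : measurable D ->
    (forall n, measurable_fun D (f_ n)) -> measurable_fun D f ->
    (\forall x \ae mu, D x -> f_ ^~ x @ \oo --> f x) ->
    mu.-integrable D (EFin \o k) ->
    (\forall x \ae mu, D x -> forall n, `|f_ n x| <= k x) ->
  mu.-integrable D (EFin \o f) /\
  (fun n => \int[mu]_(x in D) f_ n x) @ \oo --> \int[mu]_(x in D) f x.
Proof.
move=> mD mf_ mf ff ik fk.
have [|||||fi _ fc] := @dominated_convergence _ T R mu D mD
   (fun n => EFin \o f_ n) (EFin \o f) (EFin \o k).
- by move=> n; exact/measurable_EFinP.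
- exact/measurable_EFinP.
- apply: filterS ff => x ff Dx; apply/fine_cvgP; split; first exact: nearW.
  exact: ff.
- exact: ik.
- by apply: filterS fk => x fk n Dx; rewrite lee_fin; exact: fk.
split => //.
have ffin := integrable_fin_num mD fi.
by apply: fine_cvg; rewrite /= fineK.
Qed.

Lemma Rdominated_cvg0 D (f_ : nat -> T -> R) k : measurable D ->
    (forall n, measurable_fun D (f_ n)) ->
    (\forall x \ae mu, D x -> f_ ^~ x @ \oo --> (0 : R)) ->
    mu.-integrable D (EFin \o k) ->
    (\forall x \ae mu, D x -> forall n, `|f_ n x| <= k x) ->
  (fun n => \int[mu]_(x in D) f_ n x) @ \oo --> (0 : R).
Proof.
move=> mD mf_ ff ik fk.
have [//|_] := @Rdominated_cvg D f_ (cst 0) k mD mf_ _ ff ik fk.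
by rewrite Rintegral_cst// mul0r.
Qed.

End integral_bounds.

(** * Step functions on uniform grids *)

Section step_functions.
Context (R : realType).
Implicit Types (f : R -> R) (a b x y M : R) (n i : nat).

Definition mesh a b n : R := (b - a) / n.+1%:R.
Definition node a b n i : R := a + i%:R * mesh a b n.
Definition cell a b n i : set R := `[node a b n i, node a b n i.+1[.
(** The value on a cell is taken at its right end, so that right-continuity is
    enough for convergence as the mesh goes to 0. *)
Definition step a b n f x : R :=
  \sum_(i < n.+1) f (node a b n i.+1) * \1_(cell a b n i) x.

Lemma mesh_gt0 a b n : a < b -> 0 < mesh a b n.
Proof. by move=> ab; rewrite divr_gt0// subr_gt0. Qed.

Lemma node0 a b n : node a b n 0 = a.
Proof. by rewrite /node mul0r addr0. Qed.

Lemma nodeS a b n i : node a b n i.+1 = node a b n i + mesh a b n.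
Proof. by rewrite /node -addrA -natr1 mulrDl mul1r. Qed.

Lemma node_last a b n : node a b n n.+1 = b.
Proof. by rewrite /node /mesh mulrC divfK ?pnatr_eq0// addrC subrK. Qed.

Lemma le_node a b n i j : a < b -> (i <= j)%N -> node a b n i <= node a b n j.
Proof.
move=> ab ij; rewrite /node lerD2l ler_pM2r ?mesh_gt0// ler_nat//.
Qed.

Lemma cell_cover a b n x : a < b -> x \in `[a, b[ ->
  exists i : 'I_n.+1, cell a b n i x.
Proof.
move=> ab; rewrite in_itv/= => /andP[ax xb].
have : exists j, (j < n.+2)%N && (x < node a b n j).
  by exists n.+1; rewrite ltnSn node_last.
case/ex_minnP => -[|j] /andP[jn xj] jmin; first by move: xj; rewrite node0 ltNge ax.
exists (Ordinal (jn : (j < n.+1)%N)) => /=.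
rewrite /cell/= in_itv/= xj andbT leNgt; apply/negP => xj'.
by have := jmin j; rewrite xj' ltnn andbT => /(_ (ltnW jn)).
Qed.

Lemma cell_disjoint a b n i j x : a < b -> cell a b n i x -> cell a b n j x -> i = j.
Proof.
rewrite /cell/= !in_itv/= => ab /andP[ix xi] /andP[jx xj].
apply/eqP; rewrite eqn_leq; apply/andP; split; rewrite leqNgt; apply/negP => ij.
- by have := le_lt_trans (le_trans (le_node n ab ij) ix) xj; rewrite ltxx.
- by have := le_lt_trans (le_trans (le_node n ab ij) jx) xi; rewrite ltxx.
Qed.

Lemma sub_cell a b n i : a < b -> (i < n.+1)%N -> cell a b n i `<=` `[a, b[.
Proof.
move=> ab ni x; rewrite /cell/= !in_itv/= => /andP[ix xi].
have := le_trans (le_node n ab (leq0n i)) ix; rewrite node0 => ->/=.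
by have := lt_le_trans xi (le_node n ab ni); rewrite node_last.
Qed.

Lemma step_cell a b n f (i : 'I_n.+1) x : a < b -> cell a b n i x ->
  step a b n f x = f (node a b n i.+1).
Proof.
move=> ab ix; rewrite /step (bigD1 i)//= indicE mem_set// mulr1.
rewrite big1 ?addr0// => j ji; rewrite indicE memNset ?mulr0// => jx.
by move/eqP: ji; apply; apply/val_inj; exact: cell_disjoint jx ix.
Qed.

Lemma normr_step_le a b n f M x : a < b ->
  (forall y, y \in `[a, b] -> `|f y| <= M) -> `|step a b n f x| <= M.
Proof.
move=> ab fM; have [[i ix]|noi] := pselect (exists i : 'I_n.+1, cell a b n i x).
  rewrite (step_cell f ab ix); apply: fM; rewrite in_itv/=.
  have := le_node n ab (leq0n i.+1); rewrite node0 => ->/=.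
  by have := le_node n ab (ltn_ord i); rewrite node_last.
rewrite /step big1 => [|i _].
  by rewrite normr0 (le_trans _ (fM a _))// in_itv/= lexx ltW.
by rewrite indicE memNset ?mulr0// => ix; apply: noi; exists i.
Qed.

Lemma step_cvg a b f x : a < b -> x \in `[a, b[ -> f @ x^'+ --> f x ->
  (fun n => step a b n f x) @ \oo --> f x.
Proof.
move=> ab xab /cvgrPdist_le fx; apply/cvgrPdist_le => e e0.
have [dl /= dl0 xdl] := fx _ e0.
have e1 : 0 < dl / (b - a) by rewrite divr_gt0// subr_gt0.
have := near_infty_natSinv_lt (PosNum e1); apply: filterS => n /= ndl.
have [i ix] := cell_cover n ab xab; rewrite (step_cell f ab ix).
move: ix; rewrite /cell/= in_itv/= => /andP[ix xi].
apply: xdl => //; rewrite /= ltr0_norm ?subr_lt0// opprB ltrBlDr.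
rewrite nodeS addrC; apply: ltr_leD => //.
by move: ndl; rewrite ltr_pdivlMr ?subr_gt0// mulrC.
Qed.

Lemma measurable_cell a b n i : measurable (cell a b n i).
Proof. exact: measurable_itv. Qed.

Lemma measurable_step a b n f : measurable_fun setT (step a b n f).
Proof.
apply: measurable_sum => i; apply: measurable_funM; first exact: measurable_cst.
by apply: measurable_indic; exact: measurable_cell.
Qed.

(** A right-continuous function is the pointwise limit of its step functions. *)
Lemma measurable_right_continuous a b f : a < b ->
  (forall x, x \in `[a, b[ -> f @ x^'+ --> f x) -> measurable_fun `[a, b] f.
Proof.
move=> ab fc.
have -> : `[a, b]%classic = `[a, b[ `|` [set b].
  by rewrite setUitv1// bnd_simp ltW.
apply/measurable_funU => //; split; last exact: measurable_fun_set1.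
apply: (measurable_fun_cvg (fun n => measurable_funTS (measurable_step a b n f))).
by move=> x xab; apply: step_cvg => //; exact: fc.
Qed.

End step_functions.

(** * Smooth approximation of bounded functions *)

Section smooth_approximation.
Context (R : realType).
Local Notation mu := (@lebesgue_measure R).
Implicit Types (f h : R -> R) (x y z t s u v a b c e M T : R).

Lemma leb_ae_sub (P Q : R -> Prop) : (forall x, P x -> Q x) ->
  (\forall x \ae mu, P x) -> \forall x \ae mu, Q x.
Proof.
by move=> PQ; apply: filterS => //; exact: (ae_filter_ringOfSetsType mu).
Qed.

Lemma leb_ae_and (P Q : R -> Prop) : (\forall x \ae mu, P x) ->
  (\forall x \ae mu, Q x) -> \forall x \ae mu, P x /\ Q x.
Proof. by apply: filterI; exact: (ae_filter_ringOfSetsType mu). Qed.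

Lemma leb_ae_neq c : \forall x \ae mu, x != c.
Proof.
exists [set c]; split; [exact: measurable_set1|exact: lebesgue_measure_set1|].
by move=> x /= /negP; rewrite negbK => /eqP.
Qed.

Lemma is_derive_subr f h x df dh : is_derive x 1 f df -> is_derive x 1 h dh ->
  is_derive x 1 (fun t => f t - h t) (df - dh).
Proof. by move=> fd hd; exact: (@is_deriveB _ _ _ f h x 1 df dh fd hd). Qed.

Lemma is_derive_scaler f c x df : is_derive x 1 f df ->
  is_derive x 1 (fun t => c * f t) (c * df).
Proof. by move=> fd; exact: (@is_deriveZ _ _ _ f c x 1 df fd). Qed.

Lemma is_derive_shift f (c x df : R) :
  is_derive (x + c) 1 f df -> is_derive x 1 (fun t => f (t + c)) df.
Proof.
move=> fd.
have sd : is_derive x 1 (fun t : R => t + c) 1.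
  by apply: is_derive_eq; rewrite addr0.
have := @is_derive1_comp _ f (fun t => t + c) x df 1 fd sd.
by rewrite mulr1.
Qed.

(** The next four lemmas serve to differentiate the second difference quotients of
    [C1_approximation]. *)
Lemma is_derive_difference f h (r x : R) :
    (forall y, x <= y -> is_derive y 1 f (h y)) -> 0 <= r ->
  is_derive x 1 (fun t => f (t + r) - f t) (h (x + r) - h x).
Proof.
move=> fh r0; apply: is_derive_subr; last exact: fh.
by apply: is_derive_shift; apply: fh; rewrite lerDl.
Qed.

Lemma is_derive_scaled_difference f h (c r x : R) :
    (forall y, x <= y -> is_derive y 1 f (h y)) -> 0 <= r ->
  is_derive x 1 (fun t => c * (f (t + r) - f t)) (c * (h (x + r) - h x)).
Proof.
by move=> fh r0; apply: is_derive_scaler; exact: is_derive_difference.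
Qed.

Lemma continuous_difference h (r x : R) :
    (forall y, x <= y -> {for y, continuous h}) -> 0 <= r ->
  {for x, continuous (fun t => h (t + r) - h t)}.
Proof.
move=> ch r0; apply: (@cvgB _ _ _ _ _ (fun t => h (t + r)) h); last exact: ch.
apply: (@continuous_comp _ _ _ (fun s : R => s + r) h).
  by apply: cvgD; [exact: cvg_id|exact: cvg_cst].
by apply: ch; rewrite lerDl.
Qed.

Lemma continuous_scaled_difference h (c r x : R) :
    (forall y, x <= y -> {for y, continuous h}) -> 0 <= r ->
  {for x, continuous (fun t => c * (h (t + r) - h t))}.
Proof.
by move=> ch r0; apply: cvgM; [exact: cvg_cst|exact: continuous_difference].
Qed.

Lemma C1_of_is_derive f h (a b : R) :
    (forall x, x \in `[a, b] -> is_derive x 1 f (h x)) ->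
    (forall x, x \in `[a, b] -> {for x, continuous h}) ->
  C1 a b f.
Proof.
move=> fh ch; split.
- by apply: derivable_within_continuous => x xab; have [] := fh x xab.
- move=> x xab; by have [] := fh x (subset_itv_oo_cc xab).
- exists h.
    by apply: continuous_in_subspaceT => x /set_mem xab; exact: ch.
  move=> x xab; rewrite derive1E.
  by have [_ ->] := fh x (subset_itv_oo_cc xab).
Qed.

Lemma Rintegral_lipschitz h (a M x y : R) : measurable_fun setT h ->
    (forall z, `|h z| <= M) -> a <= x <= y ->
  `|\int[mu]_(z in `[a, y]) h z - \int[mu]_(z in `[a, x]) h z| <= M * (y - x).
Proof.
move=> mh hM /andP[ax xy].
have ih (b c : itv_bound R) : (mu [set` Interval b c] < +oo)%E ->
    mu.-integrable [set` Interval b c] (EFin \o h).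
  move=> fin; apply: measurable_bounded_integrable => //.
    exact: measurable_funTS.
  by exists M; split; [exact: num_real|move=> ? /ltW + ? _; exact: le_trans].
rewrite Rintegral_itvB ?bnd_simp//; last first.
  apply: ih; rewrite lebesgue_measure_itv/=.
  by case: ifPn => _; rewrite ?ltry// -EFinD ltry.
have fin : (mu `]x, y] < +oo)%E.
  rewrite lebesgue_measure_itv/=.
  by case: ifPn => _; rewrite ?ltry// -EFinD ltry.
apply: (@le_trans _ _ (\int[mu]_(z in `]x, y]) M)).
  apply: normr_Rintegral_le_ae => //.
    apply: measurable_bounded_integrable => //.
    by exists `|M|; split; [exact: num_real|move=> ? /ltW + ? _; exact: le_trans].
  by apply: aeW => z _; exact: hM.
have -> : M * (y - x) = M * fine (mu `]x, y]).
  rewrite lebesgue_measure_itv/= lte_fin.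
  case: ltP xy => [//|yx xy].
  by have -> : y = x; [apply/eqP; rewrite eq_le yx xy|rewrite subrr].
by rewrite Rintegral_cst.
Qed.

(** Let [F1] be a primitive of [h] and [F2] a primitive of [F1].  The second
    difference quotient of [F2] with step [r] is continuously differentiable and,
    by the mean value theorem, equals [(F1 (xi + r) - F1 xi) / r] for some [xi]
    between [x] and [x + r].  Hence it is bounded by [M], and it tends to [h x]
    wherever [F1] has derivative [h x], i.e. at every Lebesgue point of [h]. *)
Lemma C1_approximation h (a b M : R) : measurable_fun setT h ->
    (forall z, `|h z| <= M) ->
  exists H_ : nat -> R -> R, [/\ forall n, C1 a b (H_ n),
    forall n x, x \in `[a, b] -> `|H_ n x| <= M &
    \forall x \ae mu, x \in `[a, b] -> H_ ^~ x @ \oo --> h x].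
Proof.
move=> mh hM; have [m ma] : exists m : R, m < a by exists (a - 1); lra.
pose F1 x := \int[mu]_(z in `[m, x]) h z.
pose F2 x := \int[mu]_(z in `[m, x]) F1 z.
have fin (u v : R) : (mu `[u, v] < +oo)%E.
  rewrite lebesgue_measure_itv/=.
  by case: ifPn => _; rewrite ?ltry// -EFinD ltry.
have bdh u v : mu.-integrable `[u, v] (EFin \o h).
  apply: measurable_bounded_integrable; [by []|exact: fin|exact: measurable_funTS|].
  by exists M; split; [exact: num_real|move=> ? /ltW + ? _; exact: le_trans].
have F1lip x y : m <= x -> x <= y -> `|F1 y - F1 x| <= M * (y - x).
  by move=> x1 xy; apply: Rintegral_lipschitz => //; rewrite x1.
have F1c x : m < x -> {for x, continuous F1}.
  move=> x1; apply: (@within_continuous_continuous _ _ _ m (x + 1)).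
  - lra.
  - by apply: parameterized_integral_continuous => //; lra.
  - by rewrite in_itv/= x1/=; lra.
have F2d x : m < x -> is_derive x 1 F2 (F1 x).
  move=> x1; have [] := @continuous_FTC1_closed R F1 m x (x + 1) _ _ x1.
  - lra.
  - apply: continuous_compact_integrable; first exact: segment_compact.
    by apply: parameterized_integral_continuous => //; lra.
  - exact: F1c.
  - by move=> d; rewrite derive1E => <-; exact: derivableP.
pose r n : R := n.+1%:R^-1.
have r0 n : 0 < r n by rewrite invr_gt0.
pose psi n s := F2 (s + r n) - F2 s.
pose dpsi n s := F1 (s + r n) - F1 s.
have psid n s : m < s -> is_derive s 1 (psi n) (dpsi n s).
  move=> s1; apply: is_derive_difference; last exact: ltW.
  by move=> y sy; apply: F2d; exact: lt_le_trans sy.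
have dpsic n s : m < s -> {for s, continuous (dpsi n)}.
  move=> s1; apply: continuous_difference; last exact: ltW.
  by move=> y sy; apply: F1c; exact: lt_le_trans sy.
pose H_ n t := (r n * r n)^-1 * (psi n (t + r n) - psi n t).
have Hd n t : m < t ->
    is_derive t 1 (H_ n) ((r n * r n)^-1 * (dpsi n (t + r n) - dpsi n t)).
  move=> t1; refine (@is_derive_scaled_difference (psi n) (dpsi n) _ (r n) t _ _); last exact: ltW.
  by move=> y sy; apply: psid; exact: lt_le_trans sy.
have HE n t : m < t -> exists2 xi, t < xi < t + r n & H_ n t = (r n)^-1 * dpsi n xi.
  move=> t1; have rn := r0 n.
  have ttr : t < t + r n by lra.
  have [x||xi xit psiE] := @MVT R (psi n) (dpsi n) t (t + r n) ttr.
  - by rewrite in_itv/= => /andP[tx _]; apply: psid; lra.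
  - apply: derivable_within_continuous => x; rewrite in_itv/= => /andP[tx _].
    by have [|] := psid n x; first lra.
  - exists xi; first by move: xit; rewrite in_itv.
    rewrite /H_ psiE; field; exact: lt0r_neq0.
exists H_; split.
- move=> n; pose dH t := (r n * r n)^-1 * (dpsi n (t + r n) - dpsi n t).
  have t1 t : t \in `[a, b] -> m < t by rewrite in_itv/= => /andP[t0 _]; lra.
  have HdH t : t \in `[a, b] -> is_derive t 1 (H_ n) (dH t).
    by move=> /t1; exact: Hd.
  have cdH t : t \in `[a, b] -> {for t, continuous dH}.
    move=> /t1 {}t1.
    have dpsicn s : t <= s -> {for s, continuous (dpsi n)}.
      by move=> ts; apply: dpsic; exact: lt_le_trans ts.
    exact: (@continuous_scaled_difference _ _ _ _ dpsicn (ltW (r0 n))).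
  exact: (C1_of_is_derive HdH cdH).
- move=> n x; rewrite in_itv/= => /andP[x0 _].
  have [|xi /andP[xxi _] ->] := HE n x; first lra.
  have rn := r0 n.
  rewrite normrM [`|(r n)^-1|]gtr0_norm ?invr_gt0// [leLHS]mulrC ler_pdivrMr//.
  have := F1lip xi (xi + r n); rewrite addrAC subrr add0r; apply; lra.
- have /lebesgue_differentiation : locally_integrable setT h.
    split => //; first exact: openT.
    move=> K _ /compact_bounded [N [_ KN]].
    have KB : K `<=` `[- (`|N| + 1), `|N| + 1].
      move=> x Kx /=; rewrite in_itv/= -ler_norml.
      by apply: KN => //; have := ler_norm N; lra.
    have /integrableP[_ ] := bdh (- (`|N| + 1)) (`|N| + 1).
    apply: le_lt_trans; rewrite integral_mkcond [leRHS]integral_mkcond.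
    apply: le_ge0_integral_ae => //.
    + apply/(measurable_restrictT _ _).1 => //.
      apply: measurableT_comp => //; apply/measurable_EFinP; exact: measurable_funTS.
    + by move=> x _; apply: erestrict_ge0 => ? _; rewrite lee_fin.
    + by move=> x _; apply: erestrict_ge0.
    + apply: aeW => x _; rewrite !patchE; case: ifPn => [/set_mem/KB xK|_].
        by rewrite mem_set.
      by case: ifPn => _ //=; rewrite lee_fin.
  apply: leb_ae_sub => x lx; rewrite in_itv/= => /andP[x0 xT].
  have xx1 : x < x + 1 by lra.
  have ax : (BLeft m < BRight x)%E by rewrite lte_fin; lra.
  have [F1d F1x] := @FTC1_lebesgue_pt R h (BLeft m) x (x + 1) xx1 (bdh _ _) ax lx.
  have : is_derive x 1 F1 (h x) by rewrite -F1x derive1E; exact: derivableP.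
  move=> /is_derive1_caratheodory[q [F1q qc qx]].
  apply/cvgrPdist_le => e e0.
  have e30 : 0 < e / 3 by rewrite divr_gt0.
  have /nbhs_ballP[dl /= dl0 qdl] : \forall y \near x, `|h x - q y| <= e / 3.
    by move/cvgrPdist_le : qc; rewrite qx; exact.
  have rdl : \forall n \near \oo, r n < dl / 2.
    have dl2 : 0 < dl / 2 by rewrite divr_gt0.
    exact: (near_infty_natSinv_lt (PosNum dl2)).
  near=> n.
  have [|xi /andP[xxi xir] ->] := HE n x; first lra.
  have rn := r0 n.
  have rnd : r n < dl / 2 by near: n.
  have q1 : `|h x - q xi| <= e / 3.
    by apply: qdl; rewrite /ball/= ltr0_norm; lra.
  have q2 : `|h x - q (xi + r n)| <= e / 3.
    by apply: qdl; rewrite /ball/= ltr0_norm; lra.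
  (* [q] is the slope of [F1] seen from [x]; both ends of the difference are
     within [2 r] of [x]. *)
  have -> : h x - (r n)^-1 * dpsi n xi =
      ((h x - q (xi + r n)) * (xi + r n - x) - (h x - q xi) * (xi - x)) / r n.
    rewrite /dpsi -[F1 (xi + r n)](subrK (F1 x)) -[F1 xi](subrK (F1 x)) !F1q.
    by field; exact: lt0r_neq0.
  rewrite normrM [`|(r n)^-1|]gtr0_norm ?invr_gt0// ler_pdivrMr//.
  apply: le_trans (ler_normB _ _) _; rewrite !normrM.
  rewrite [`|xi + _ - x|]gtr0_norm ?[`|xi - x|]gtr0_norm; [|lra..].
  have := ler_pM (normr_ge0 _) (ltW rn) q1 (lexx _).
  nra.
Unshelve. all: by end_near. Qed.

End smooth_approximation.

(** * Representation of absolutely continuous functionals *)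

Section C1_functions.
Context (R : realType).
Implicit Types (f h : R -> R) (a b c x y M : R).

Lemma cvg_linear c (u v : nat -> R) (l l' : R) :
  u @ \oo --> l -> v @ \oo --> l' -> (fun n => c * u n + v n) @ \oo --> c * l + l'.
Proof. by move=> ul vl; apply: cvgD vl; apply: cvgM ul; exact: cvg_cst. Qed.

Lemma cvg_sumr (I : Type) (s : seq I) (u : I -> nat -> R) (l : I -> R) :
  (forall i, u i @ \oo --> l i) ->
  (fun n => \sum_(i <- s) u i n) @ \oo --> \sum_(i <- s) l i.
Proof.
move=> ul; elim: s => [|i s IH].
  by under eq_fun do rewrite big_nil; rewrite big_nil; exact: cvg_cst.
under eq_fun do rewrite big_cons.
by rewrite big_cons; apply: cvgD; [exact: ul|exact: IH].
Qed.

Lemma C1_linear a b c f h : C1 a b f -> C1 a b h -> C1 a b (fun t => c * f t + h t).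
Proof.
move=> [fc fd [f' f'c ff']] [hc hd [h' h'c hh']]; split.
- by move=> x; apply: cvgD; [apply: cvgM; [exact: cvg_cst|exact: fc]|exact: hc].
- move=> x xab; have dcf := @derivableZ _ _ _ f c x 1 (fd x xab).
  exact: (@derivableD _ _ _ (c \*: f) h x 1 dcf (hd x xab)).
- exists (fun t => c * f' t + h' t).
    by move=> x; apply: cvgD; [apply: cvgM; [exact: cvg_cst|exact: f'c]|exact: h'c].
  move=> x xab; rewrite -ff'// -hh'// !derive1E.
  have dcf := @derivableZ _ _ _ f c x 1 (fd x xab).
  rewrite [LHS](@deriveD _ _ _ (c \*: f) h x 1 dcf (hd x xab)).
  by rewrite (@deriveZ _ _ _ f c x 1 (fd x xab)).
Qed.

Lemma C1_cst a b c : C1 a b (fun=> c).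
Proof.
split.
- by move=> x; exact: cvg_cst.
- by move=> x _; exact: derivable_cst.
- exists (cst 0); first by move=> x; exact: cvg_cst.
  by move=> x _; rewrite derive1_cst.
Qed.

Lemma C1_scale a b c f : C1 a b f -> C1 a b (fun t => c * f t).
Proof.
move=> f1; have := C1_linear c f1 (C1_cst a b 0).
by under eq_fun do rewrite addr0.
Qed.

Lemma within_continuous_bounded a b f : {within `[a, b], continuous f} ->
  exists M, forall x, x \in `[a, b] -> `|f x| <= M.
Proof.
move=> fc; have := continuous_compact fc (@segment_compact R a b).
move=> /compact_bounded[M [_ MP]]; exists (`|M| + 1) => x xab.
by apply: MP; [have := ler_norm M; lra|exists x].
Qed.

End C1_functions.

Section integral_representation.
Context (R : realType) (T : R) (T0 : 0 < T) (ell : (R -> R) -> R) (I0 : R).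
Local Notation mu := (@lebesgue_measure R).
Local Notation D := (`[0, T]%classic : set (measurableTypeR R)).
Implicit Types (f h : R -> R) (c x t M : R).
Context (ell_linear : forall c f h, C1 0 T f -> C1 0 T h ->
  ell (fun t => c * f t + h t) = c * ell f + ell h).
Context (ell_bounded : forall M, exists k : R -> R,
  [/\ mu.-integrable D (EFin \o k), forall t, D t -> 0 <= k t &
     forall H : R -> R, C1 0 T H -> (forall t, D t -> `|H t| <= M) ->
       ell H <= I0 + \int[mu]_(t in D) (`|H t| * k t)]).

Let mD : measurable D. Proof. exact: measurable_itv. Qed.

Let I0_ge0 : 0 <= I0.
Proof.
have [k [_ _ /(_ (fun=> 0))]] := ell_bounded 0.
have ell0 : ell (fun=> 0) = 0.
  have := ell_linear 1 (C1_cst 0 T 0) (C1_cst 0 T 0).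
  under eq_fun do rewrite mulr0 addr0.
  lra.
rewrite ell0 => /(_ (C1_cst 0 T 0)).
under eq_Rintegral do rewrite normr0 mul0r.
rewrite Rintegral_cst// mul0r addr0; apply => t _.
by rewrite normr0.
Qed.

(** Apply the bound to [l * H] and [- l * H] with [l] so large that [I0 / l <= e]. *)
Let ell_small M e : 0 < e -> exists k : R -> R,
  [/\ mu.-integrable D (EFin \o k), forall t, D t -> 0 <= k t &
     forall H : R -> R, C1 0 T H -> (forall t, D t -> `|H t| <= M) ->
       `|ell H| <= e + \int[mu]_(t in D) (`|H t| * k t)].
Proof.
move=> e0; pose l := (I0 + 1) / e.
have l0 : 0 < l by rewrite divr_gt0// ltr_wpDl.
have [k [ik k0 kP]] := ell_bounded (l * M).
exists k; split=> // H H1 HM.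
have ellZ c : ell (fun t => c * H t) = c * ell H.
  have := ell_linear c H1 (C1_cst 0 T 0).
  under eq_fun do rewrite addr0.
  move=> ->; have := ell_linear 1 (C1_cst 0 T 0) (C1_cst 0 T 0).
  under eq_fun do rewrite mulr0 addr0.
  lra.
have bnd c : `|c| = l -> c * ell H <= I0 + l * \int[mu]_(t in D) (`|H t| * k t).
  move=> cl; rewrite -ellZ; apply: le_trans (kP _ _ _) _.
  - exact: C1_scale.
  - by move=> t Dt; rewrite normrM cl ler_pM2l//; exact: HM.
  - rewrite lerD2l -RintegralZl//.
      rewrite le_eqVlt; apply/orP; left; apply/eqP; apply: eq_Rintegral => t _.
      by rewrite normrM cl mulrA.
    have HkM : mu.-integrable D (EFin \o (fun t => M * k t)).
      exact: integrable_scale.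
    apply: le_integrable HkM => //.
      apply/measurable_EFinP/measurable_funM.
        apply: measurableT_comp => //; case: H1 => Hc _ _.
        exact: subspace_continuous_measurable_fun.
      by case/integrableP : ik => /measurable_EFinP.
    move=> t Dt /=; rewrite lee_fin !normrM normr_id.
    by apply: ler_wpM2r => //; apply: le_trans (HM t Dt) (ler_norm _).
have le1 : l * ell H <= I0 + l * \int[mu]_(t in D) (`|H t| * k t).
  by apply: bnd; rewrite gtr0_norm.
have le2 : - l * ell H <= I0 + l * \int[mu]_(t in D) (`|H t| * k t).
  by apply: bnd; rewrite normrN gtr0_norm.
have I0l : I0 <= l * e by rewrite /l divfK ?lt0r_neq0//; lra.
rewrite ler_norml; apply/andP; split.
  by rewrite -(ler_pM2l l0); lra.
by rewrite -(ler_pM2l l0); lra.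
Qed.

(** Bounded almost everywhere convergence, the mode of convergence under which
    [ell] is continuous. *)
Definition C1_approximates (h : R -> R) (H_ : nat -> R -> R) : Prop := exists M : R,
  [/\ forall n, C1 0 T (H_ n), forall n t, D t -> `|H_ n t| <= M,
      forall t, D t -> `|h t| <= M &
      \forall t \ae mu, D t -> H_ ^~ t @ \oo --> h t].

Definition bounded_measurable (h : R -> R) : Prop :=
  measurable_fun D h /\ exists M, forall t, D t -> `|h t| <= M.

Let C1_measurable (H : R -> R) : C1 0 T H -> measurable_fun D H.
Proof. by case=> Hc _ _; exact: subspace_continuous_measurable_fun. Qed.

Let C1_bounded_measurable (H : R -> R) : C1 0 T H -> bounded_measurable H.
Proof.
move=> H1; split; first exact: C1_measurable.
by case: H1 => /within_continuous_bounded.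
Qed.

Let approximates_linear c f h (F_ H_ : nat -> R -> R) :
  C1_approximates f F_ -> C1_approximates h H_ ->
  C1_approximates (fun t => c * f t + h t) (fun n t => c * F_ n t + H_ n t).
Proof.
move=> [M1 [F1 FM fM Ff]] [M2 [H1 HM hM Hh]].
exists (`|c| * M1 + M2); split.
- by move=> n; exact: C1_linear.
- move=> n t Dt; apply: le_trans (ler_normD _ _) _; rewrite normrM.
  by rewrite lerD ?ler_wpM2l ?FM ?HM.
- move=> t Dt; apply: le_trans (ler_normD _ _) _; rewrite normrM.
  by rewrite lerD ?ler_wpM2l ?fM ?hM.
- apply: leb_ae_sub (leb_ae_and Ff Hh) => t [Ft Ht] Dt.
  by apply: cvgD; [apply: cvgM; [exact: cvg_cst|exact: Ft]|exact: Ht].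
Qed.

Let integral_error_cvg0 h H_ k : measurable_fun D h -> C1_approximates h H_ ->
    mu.-integrable D (EFin \o k) -> (forall t, D t -> 0 <= k t) ->
  (fun n => \int[mu]_(t in D) (`|H_ n t - h t| * k t)) @ \oo --> (0 : R).
Proof.
move=> mh [M [H1 HM hM Hh]] ik k0.
have mk : measurable_fun D k by case/integrableP : ik => /measurable_EFinP.
apply: (@Rdominated_cvg0 _ _ _ mu D (fun n t => `|H_ n t - h t| * k t)
  (fun t => (M + M) * k t)) => //.
- move=> n; apply: measurable_funM => //; apply: measurableT_comp => //.
  by apply: measurable_funB => //; exact: C1_measurable.
- apply: leb_ae_sub Hh => t Ht Dt.
  rewrite -[X in _ --> X](mul0r (k t)) -(normr0 R) -(subrr (h t)).
  apply: cvgM; last exact: cvg_cst.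
  by apply: cvg_norm; apply: cvgB; [exact: Ht|exact: cvg_cst].
- exact: integrable_scale.
- apply: aeW => t Dt n; rewrite normrM normr_id (ger0_norm (k0 t Dt)).
  apply: ler_wpM2r; first exact: k0.
  by apply: le_trans (ler_normB _ _) _; apply: lerD; [exact: HM|exact: hM].
Qed.

(** For two indices the difference is at most [e] plus the integral errors with
    respect to the limit, which vanish by dominated convergence. *)
Let ell_cauchy h H_ : measurable_fun D h -> C1_approximates h H_ ->
  cvg (ell \o H_ @ \oo).
Proof.
move=> mh aH; apply: cauchy_cvg; apply: cauchy_exP => e e0.
have [M [H1 HM hM _]] := aH.
have e40 : 0 < e / 4 by rewrite divr_gt0.
have [k [ik k0 kP]] := ell_small (M + M) e40.
have := integral_error_cvg0 mh aH ik k0.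
move=> /cvgrPdist_lt/(_ _ e40)[N _ err].
have mk : measurable_fun D k by case/integrableP : ik => /measurable_EFinP.
have mH n : measurable_fun D (H_ n) by exact: C1_measurable.
have ierr n : mu.-integrable D (EFin \o (fun t => `|H_ n t - h t| * k t)).
  apply: (le_integrable _ _ _ (integrable_scale (M + M) mD ik)) => //.
    apply/measurable_EFinP; apply: measurable_funM => //; apply: measurableT_comp => //.
    exact: measurable_funB.
  move=> t Dt /=; rewrite lee_fin !normrM normr_id.
  apply: ler_wpM2r => //; rewrite (le_trans _ (ler_norm _))//.
  by apply: le_trans (ler_normB _ _) _; apply: lerD; [exact: HM|exact: hM].
exists (ell (H_ N)); exists N => // n Nn; rewrite /ball/=.
have -> : ell (H_ N) - ell (H_ n) = ell (fun t => -1 * H_ n t + H_ N t).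
  by rewrite ell_linear// mulN1r addrC.
apply: le_lt_trans (kP _ _ _) _.
- exact: C1_linear.
- move=> t Dt; rewrite mulN1r; apply: le_trans (ler_normD _ _) _.
  by rewrite normrN; apply: lerD; exact: HM.
have eE : e / 4 + (e / 4 + (e / 4 + e / 4)) = e by field.
rewrite -[ltRHS]eE; apply: ler_ltD => //.
apply: (@le_lt_trans _ _ (\int[mu]_(t in D) (`|H_ n t - h t| * k t) +
    \int[mu]_(t in D) (`|H_ N t - h t| * k t))).
  rewrite -RintegralD//; apply: le_Rintegral => //.
  - apply: (le_integrable _ _ _ (integrable_scale (M + M) mD ik)) => //.
      apply/measurable_EFinP; apply: measurable_funM => //; apply: measurableT_comp => //.
      apply: measurable_funD => //; exact: measurable_funM.
    move=> t Dt /=; rewrite lee_fin !normrM normr_id mulN1r.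
    apply: ler_wpM2r => //; rewrite (le_trans _ (ler_norm _))//.
    by apply: le_trans (ler_normD _ _) _; rewrite normrN; apply: lerD; exact: HM.
  - exact: (integrableD mD (ierr n) (ierr N)).
  - move=> t Dt; rewrite -mulrDl; apply: ler_wpM2r; first exact: k0.
    have -> : -1 * H_ n t + H_ N t = (H_ N t - h t) - (H_ n t - h t) by ring.
    by rewrite [leRHS]addrC; exact: ler_normB.
have int0 n' : 0 <= \int[mu]_(t in D) (`|H_ n' t - h t| * k t).
  by apply: Rintegral_ge0 => t Dt; rewrite mulr_ge0// k0.
have small m : (N <= m)%N -> \int[mu]_(t in D) (`|H_ m t - h t| * k t) < e / 4.
  by move=> Nm; have := err m Nm; rewrite /= sub0r normrN ger0_norm.
by have := small _ Nn; have := small _ (leqnn N); lra.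
Qed.

Let approximates_cst (H : R -> R) : C1 0 T H -> C1_approximates H (fun=> H).
Proof.
move=> H1; have [M HM] := (C1_bounded_measurable H1).2.
exists M; split => //.
by apply: aeW => t _; exact: cvg_cst.
Qed.

Let approximable h : bounded_measurable h -> exists H_, C1_approximates h H_.
Proof.
move=> [mh [M hM]].
have mh' : measurable_fun setT (h \_ D) by exact/(measurable_restrictT _ _).1.
have hM' t : `|(h \_ D) t| <= `|M|.
  rewrite patchE; case: ifPn => [/set_mem/hM tM|_]; last by rewrite normr0.
  exact: le_trans tM (ler_norm _).
have [H_ [H1 HM Hh]] := C1_approximation 0 T mh' hM'.
exists H_, `|M|; split => //.
- by move=> t Dt; apply: le_trans (hM t Dt) (ler_norm _).
- apply: leb_ae_sub Hh => t Ht Dt.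
  by have := Ht Dt; rewrite patchE mem_set.
Qed.

(** The extension of [ell] by continuity; the limit does not depend on the
    approximating sequence, by [extension_unique]. *)
Definition extension (h : R -> R) : R := xget 0
  [set l | exists2 H_, C1_approximates h H_ & ell \o H_ @ \oo --> l].

Let extensionP h : bounded_measurable h ->
  exists2 H_, C1_approximates h H_ & ell \o H_ @ \oo --> extension h.
Proof.
move=> bh; rewrite /extension; case: xgetP => [l _ //|].
have [H_ aH] := approximable bh.
move=> nl; exfalso; apply: (nl (lim (ell \o H_ @ \oo))).
by exists H_ => //; apply: (ell_cauchy _ aH); case: bh.
Qed.

Let ell_cvg0 H_ : C1_approximates (fun=> 0) H_ -> ell \o H_ @ \oo --> (0 : R).
Proof.
move=> aH; have [M [H1 HM _ _]] := aH.
apply/cvgrPdist_lt => e e0.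
have e20 : 0 < e / 2 by rewrite divr_gt0.
have [k [ik k0 kP]] := ell_small M e20.
have := integral_error_cvg0 (measurable_cst _) aH ik k0.
move=> /cvgrPdist_lt/(_ _ e20); apply: filterS => n.
under eq_Rintegral do rewrite subr0.
rewrite !sub0r !normrN => err.
apply: le_lt_trans (kP _ (H1 n) (HM n)) _.
rewrite [ltRHS](splitr e) ltrD2l.
by apply: le_lt_trans err; exact: ler_norm.
Qed.

Let extension_unique h H_ : bounded_measurable h -> C1_approximates h H_ ->
  ell \o H_ @ \oo --> extension h.
Proof.
move=> bh aH; have [F_ aF Fl] := extensionP bh.
have := approximates_linear (-1) aF aH.
have -> : (fun t => -1 * h t + h t) = (fun=> 0).
  by apply/funext => t; rewrite mulN1r addNr.
have [_ [F1 _ _ _]] := aF; have [_ [H1 _ _ _]] := aH.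
move=> /ell_cvg0 d0.
have -> : ell \o H_ = (fun n => (ell \o (fun n t => -1 * F_ n t + H_ n t)) n + (ell \o F_) n).
  by apply/funext => n /=; rewrite ell_linear//; ring.
by rewrite -[X in _ --> X]add0r; exact: cvgD.
Qed.

Let bounded_measurable_linear c f h : bounded_measurable f ->
  bounded_measurable h -> bounded_measurable (fun t => c * f t + h t).
Proof.
move=> [mf [M fM]] [mh [M' hM]]; split.
  by apply: measurable_funD => //; exact: measurable_funM.
exists (`|c| * M + M') => t Dt.
apply: le_trans (ler_normD _ _) _; rewrite normrM.
by rewrite lerD ?ler_wpM2l ?fM ?hM.
Qed.

Let extension_linear c f h : bounded_measurable f -> bounded_measurable h ->
  extension (fun t => c * f t + h t) = c * extension f + extension h.
Proof.
move=> bf bh; have [F_ aF Fl] := extensionP bf; have [H_ aH Hl] := extensionP bh.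
have [_ [F1 _ _ _]] := aF; have [_ [H1 _ _ _]] := aH.
have := extension_unique (bounded_measurable_linear c bf bh) (approximates_linear c aF aH).
move=> /(cvg_lim (@Rhausdorff R)) <-; apply: (cvg_lim (@Rhausdorff R)).
have -> : ell \o (fun n t => c * F_ n t + H_ n t) =
    (fun n => c * (ell \o F_) n + (ell \o H_) n).
  by apply/funext => n /=; exact: ell_linear.
apply: cvg_linear; [exact: Fl|exact: Hl].
Qed.

Let extension_C1 (H : R -> R) : C1 0 T H -> extension H = ell H.
Proof.
move=> H1; have := extension_unique (C1_bounded_measurable H1) (approximates_cst H1).
move=> /(cvg_lim (@Rhausdorff R)) <-; apply: (cvg_lim (@Rhausdorff R)).
exact: cvg_cst.
Qed.

(** The estimate [ell_small] passes to the limit. *)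
Let extension_small M e : 0 < e -> exists k : R -> R,
  [/\ mu.-integrable D (EFin \o k), forall t, D t -> 0 <= k t &
     forall h, measurable_fun D h -> (forall t, D t -> `|h t| <= M) ->
       `|extension h| <= e + \int[mu]_(t in D) (`|h t| * k t)].
Proof.
move=> e0; have [k [ik k0 kP]] := ell_small `|M| e0.
exists k; split => // h mh hM.
have hM' t : D t -> `|h t| <= `|M|.
  by move=> Dt; apply: le_trans (hM t Dt) (ler_norm _).
have mk : measurable_fun D k by case/integrableP : ik => /measurable_EFinP.
have mh' : measurable_fun setT (h \_ D) by exact/(measurable_restrictT _ _).1.
have hM'' t : `|(h \_ D) t| <= `|M|.
  by rewrite patchE; case: ifPn => [/set_mem/hM'//|_]; rewrite normr0.
have [H_ [H1 HM Hh]] := C1_approximation 0 T mh' hM''.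
have {}Hh : \forall t \ae mu, D t -> H_ ^~ t @ \oo --> h t.
  by apply: leb_ae_sub Hh => t Ht Dt; have := Ht Dt; rewrite patchE mem_set.
have aH : C1_approximates h H_ by exists `|M|; split.
have bh : bounded_measurable h by split => //; exists M.
have mH n : measurable_fun D (H_ n) by exact: C1_measurable.
have [_ intH] : mu.-integrable D (EFin \o (fun t => `|h t| * k t)) /\
    (fun n => \int[mu]_(t in D) (`|H_ n t| * k t)) @ \oo -->
    \int[mu]_(t in D) (`|h t| * k t).
  apply: (@Rdominated_cvg _ _ _ mu D (fun n t => `|H_ n t| * k t)
    (fun t => `|h t| * k t) (fun t => `|M| * k t)) => //.
  - by move=> n; apply: measurable_funM => //; exact: measurableT_comp.
  - by apply: measurable_funM => //; exact: measurableT_comp.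
  - apply: leb_ae_sub Hh => t Ht Dt.
    by apply: cvgM; [apply: cvg_norm; exact: Ht|exact: cvg_cst].
  - exact: integrable_scale.
  - apply: aeW => t Dt n; rewrite normrM normr_id (ger0_norm (k0 t Dt)).
    by apply: ler_wpM2r; [exact: k0|exact: HM].
have le_n n : `|(ell \o H_) n| <= e + \int[mu]_(t in D) (`|H_ n t| * k t).
  exact: kP (H1 n) (HM n).
have c1 : (fun n => `|(ell \o H_) n|) @ \oo --> `|extension h|.
  exact: cvg_norm (extension_unique bh aH).
have c2 : (fun n => e + \int[mu]_(t in D) (`|H_ n t| * k t)) @ \oo -->
    e + \int[mu]_(t in D) (`|h t| * k t).
  by apply: cvgD intH; exact: cvg_cst.
apply: (ler_cvg_to c1 c2); exact: nearW.
Qed.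

Let extension_dominated (h_ : nat -> R -> R) h M : (forall n, measurable_fun D (h_ n)) ->
    measurable_fun D h -> (forall n t, D t -> `|h_ n t| <= M) ->
    (forall t, D t -> `|h t| <= M) ->
    (\forall t \ae mu, D t -> h_ ^~ t @ \oo --> h t) ->
  (extension \o h_) @ \oo --> extension h.
Proof.
move=> mh_ mh hM_ hM hh.
apply/cvgrPdist_le => e e0.
have e20 : 0 < e / 2 by rewrite divr_gt0.
have [k [ik k0 kP]] := extension_small (M + M) e20.
have mk : measurable_fun D k by case/integrableP : ik => /measurable_EFinP.
have mdiff n : measurable_fun D (fun t => -1 * h_ n t + h t).
  by apply: measurable_funD => //; exact: measurable_funM.
have diffM n t : D t -> `|-1 * h_ n t + h t| <= M + M.
  move=> Dt; rewrite mulN1r; apply: le_trans (ler_normD _ _) _; rewrite normrN.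
  by apply: lerD; [exact: hM_|exact: hM].
have : (fun n => \int[mu]_(t in D) (`|-1 * h_ n t + h t| * k t)) @ \oo --> (0 : R).
  apply: (@Rdominated_cvg0 _ _ _ mu D (fun n t => `|-1 * h_ n t + h t| * k t)
    (fun t => (M + M) * k t)) => //.
  - by move=> n; apply: measurable_funM => //; exact: measurableT_comp.
  - apply: leb_ae_sub hh => t ht Dt.
    rewrite -[X in _ --> X](mul0r (k t)) -(normr0 R).
    have -> : (0 : R) = -1 * h t + h t by rewrite mulN1r addNr.
    apply: cvgM; last exact: cvg_cst.
    by apply: cvg_norm; apply: cvg_linear; [exact: ht|exact: cvg_cst].
  - exact: integrable_scale.
  - apply: aeW => t Dt n; rewrite normrM normr_id (ger0_norm (k0 t Dt)).
    by apply: ler_wpM2r; [exact: k0|exact: diffM].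
move=> /cvgrPdist_le/(_ _ e20); apply: filterS => n.
rewrite sub0r normrN => small.
have b_ n' : bounded_measurable (h_ n') by split => //; exists M; exact: hM_.
have bh : bounded_measurable h by split => //; exists M.
have -> : extension h - (extension \o h_) n = extension (fun t => -1 * h_ n t + h t).
  by rewrite extension_linear//= mulN1r addrC.
apply: le_trans (kP _ (mdiff n) (diffM n)) _.
rewrite [leRHS](splitr e) lerD2l.
by apply: le_trans small; exact: ler_norm.
Qed.

Let bounded_indic (A : set (measurableTypeR R)) : measurable A -> bounded_measurable \1_A.
Proof.
move=> mA; split; first exact: measurable_indic.
by exists 1 => t _; rewrite indicE; case: (_ \in _); rewrite ?normr1 ?normr0.
Qed.

Let bounded_cst0 : bounded_measurable (fun=> 0).
Proof. by split => //; exists 0 => t _; rewrite normr0. Qed.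

Let extension0 : extension (fun=> 0) = 0.
Proof.
have := extension_linear (-1) bounded_cst0 bounded_cst0.
have -> : (fun t => -1 * (fun=> 0 : R) t + (fun=> 0 : R) t) = (fun=> 0 : R).
  by apply/funext => t; rewrite mulr0 addr0.
lra.
Qed.

Let extension_sum (I : Type) (s : seq I) (c : I -> R) (f : I -> R -> R) :
  (forall i, bounded_measurable (f i)) ->
  bounded_measurable (fun t => \sum_(i <- s) c i * f i t) /\
  extension (fun t => \sum_(i <- s) c i * f i t) = \sum_(i <- s) c i * extension (f i).
Proof.
move=> bf; elim: s => [|i s [bs IH]].
  by under eq_fun do rewrite big_nil; rewrite big_nil extension0.
under eq_fun do rewrite big_cons.
split; first exact: bounded_measurable_linear.
by rewrite big_cons extension_linear// IH.
Qed.

(** The signed measure whose density represents [ell]. *)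
Let nu (A : set (measurableTypeR R)) : \bar R := (extension \1_A)%:E.

Let nu0 : nu set0 = 0%E.
Proof. by rewrite /nu indic0; congr EFin; exact: extension0. Qed.

(** Partial sums of indicators converge boundedly, and the extension is continuous
    for this convergence. *)
Let nu_sigma_additive : semi_sigma_additive nu.
Proof.
move=> F mF tF mUF; rewrite /nu.
have -> : (fun n => \sum_(0 <= i < n) (extension \1_(F i))%:E)%E =
    EFin \o (extension \o (fun n t => \sum_(0 <= i < n) 1 * \1_(F i) t)).
  apply/funext => n /=; rewrite sumEFin; congr EFin.
  rewrite (extension_sum _ _ (fun i => bounded_indic (mF i))).2.
  by apply: eq_bigr => i _; rewrite mul1r.
apply/fine_cvgP; split; first exact: nearW.
have sumE n t : \sum_(0 <= i < n) 1 * \1_(F i) t = \1_(\big[setU/set0]_(i < n) F i) t :> R.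
  rewrite big_mkord; under eq_bigr do rewrite mul1r.
  rewrite indicE; case: (boolP (t \in _)) => [/set_mem|tU].
    rewrite -bigcup_mkord => -[j jn Fjt].
    rewrite (bigD1 (Ordinal jn))//= indicE mem_set// big1 ?addr0// => i ij.
    rewrite indicE memNset// => Fit.
    have := tF i j I I (ex_intro _ t (conj Fit Fjt)).
    by move=> ijE; move/eqP: ij; apply; exact: val_inj.
  rewrite big1// => i _; rewrite indicE memNset// => Fit.
  by move/negP: tU; apply; apply/mem_set; rewrite -bigcup_mkord; exists i => //=; exact: ltn_ord.
have ind1 (A : set R) t : `|\1_A t : R| <= 1.
  by rewrite indicE; case: (_ \in _); rewrite ?normr1 ?normr0.
apply: (@extension_dominated _ _ 1) => //.
- by move=> n; apply: (extension_sum _ _ (fun i => bounded_indic (mF i))).1.1.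
- by move=> n t _; rewrite sumE.
- apply: aeW => t _; under eq_fun do rewrite sumE.
  rewrite indicE; case: (boolP (t \in _)) => [/set_mem[j _ Fjt]|tU].
    apply: cvg_near_cst; exists j.+1 => // n /= jn.
    by rewrite indicE mem_set// -bigcup_mkord; exists j.
  apply: cvg_near_cst; apply: nearW => n; rewrite indicE memNset//.
  rewrite -bigcup_mkord => -[j _ Fjt].
  by move/negP: tU; apply; apply/mem_set; exists j.
Qed.

(** The zero function approximates the indicator of a null set. *)
Let nu_null (A : set (measurableTypeR R)) : measurable A -> mu A = 0%E -> nu A = 0%E.
Proof.
move=> mA A0; rewrite /nu; congr EFin.
have aA : C1_approximates \1_A (fun _ _ => 0).
  exists 1; split.
  - by move=> _; exact: C1_cst.
  - by move=> n t _; rewrite normr0.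
  - by move=> t _; rewrite indicE; case: (_ \in _); rewrite ?normr1 ?normr0.
  - have : \forall t \ae mu, ~ A t.
      by exists A; split => // t /= /contrapT.
    apply: leb_ae_sub => t At _; rewrite indicE memNset//; exact: cvg_cst.
have := extension_unique (bounded_indic mA) aA.
move=> /(cvg_lim (@Rhausdorff R)) <-; apply: (cvg_lim (@Rhausdorff R)).
rewrite -[in X in _ --> X]extension0 (extension_C1 (C1_cst 0 T 0)); exact: cvg_cst.
Qed.

(** A linear functional on C^1([0,T]) which is bounded above as in [ell_bounded]
    has an integrable density.  The Radon-Nikodym derivative of [nu] represents the
    extension on indicators, hence on step functions, and a C^1 function is the
    bounded limit of its step functions. *)
Lemma integral_representation : exists2 P : R -> R,
  mu.-integrable D (EFin \o P) &
  forall H : R -> R, C1 0 T H -> ell H = \int[mu]_(t in D) (H t * P t).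
Proof.
pose nuC : {charge set (measurableTypeR R) -> \bar R} := HB.pack nu
  (isCharge.Build _ _ _ nu nu0 (fun _ _ => isT) nu_sigma_additive).
have nu_mu : nuC `<< mu.
  move=> A /= A0 B mB BA; apply: nu_null => //; exact: A0.
pose P0 := Radon_Nikodym nuC mu.
have iP0 : mu.-integrable setT P0 := Radon_Nikodym_integrable nu_mu.
pose P := fine \o P0.
have P0E : EFin \o P = P0.
  by apply/funext => x; rewrite /= fineK// Radon_Nikodym_fin_num.
have iP : mu.-integrable D (EFin \o P).
  by rewrite P0E; apply: integrableS iP0.
have mP : measurable_fun D P by case/integrableP : iP => /measurable_EFinP.
exists P => // H H1.
have restr (A : set (measurableTypeR R)) : measurable A -> A `<=` D ->
    extension \1_A = \int[mu]_(t in D) (\1_A t * P t).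
  move=> mA AD; have := Radon_Nikodym_integral nu_mu mA.
  rewrite /= /nu -/P0 -P0E => /(congr1 fine) /= ->.
  rewrite -/(Rintegral mu A P) -(setIidr AD) Rintegral_mkcondr.
  apply: eq_Rintegral => t _; rewrite setIidr// patchE indicE.
  by case: ifPn; rewrite ?mul1r ?mul0r.
have bH := C1_bounded_measurable H1; have [_ [M HM]] := bH.
have bcell n i : bounded_measurable \1_(cell 0 T n i).
  by apply: bounded_indic; exact: measurable_cell.
have stepE n : extension (step 0 T n H) = \int[mu]_(t in D) (step 0 T n H t * P t).
  rewrite (extension_sum _ _ (fun i : 'I_n.+1 => bcell n i)).2.
  have icell i : mu.-integrable D (EFin \o (fun t => \1_(cell 0 T n i) t * P t)).
    apply: le_integrable iP => //.
      apply/measurable_EFinP; apply: measurable_funM => //.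
      by apply: measurable_indic; exact: measurable_cell.
    move=> t _ /=; rewrite lee_fin normrM ler_piMl// indicE.
    by case: (_ \in _); rewrite ?normr1 ?normr0.
  have iccell (i : 'I_n.+1) := integrable_scale (H (node 0 T n i.+1)) mD (icell i).
  transitivity (\int[mu]_(t in D) \sum_(i < n.+1)
      H (node 0 T n i.+1) * (\1_(cell 0 T n i) t * P t)).
    rewrite (Rintegral_sum _ mD iccell).2; apply: eq_bigr => i _.
    rewrite RintegralZl//; congr (_ * _); apply: restr; first exact: measurable_cell.
    apply: subset_trans (sub_cell T0 (ltn_ord i)) _; exact: subset_itv_co_cc.
  apply: eq_Rintegral => t _; rewrite /step mulr_suml.
  by apply: eq_bigr => i _; rewrite mulrA.
have [Hc _ _] := H1.
have Hright t : t \in `[0, T[ -> (fun n => step 0 T n H t) @ \oo --> H t.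
  move=> tT; apply: step_cvg => //.
  have /(continuous_within_itvP _ T0)[Hi H0 _] := Hc.
  move: tT; rewrite in_itv/= le_eqVlt => /andP[/predU1P[<-//|t0 tT]].
  by apply: cvg_at_right_filter; apply: Hi; rewrite in_itv/= t0.
have mstep n : measurable_fun D (step 0 T n H).
  by apply: measurable_funTS; exact: measurable_step.
have aestep : \forall t \ae mu, D t -> (fun n => step 0 T n H t) @ \oo --> H t.
  apply: leb_ae_sub (leb_ae_neq T) => t tT Dt; apply: Hright.
  by move: Dt; rewrite /= !in_itv/= lt_neqAle tT => /andP[-> ->].
have stepM n t : `|step 0 T n H t| <= M.
  by apply: normr_step_le => // s sT; exact: HM.
have mH : measurable_fun D H := C1_measurable H1.
have c1 : (extension \o (fun n => step 0 T n H)) @ \oo --> ell H.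
  rewrite -extension_C1//; apply: (@extension_dominated _ _ M) => //.
have [? c2] : mu.-integrable D (EFin \o (fun t => H t * P t)) /\
    (fun n => \int[mu]_(t in D) (step 0 T n H t * P t)) @ \oo -->
    \int[mu]_(t in D) (H t * P t).
  apply: (@Rdominated_cvg _ _ _ mu D (fun n t => step 0 T n H t * P t)
    (fun t => H t * P t) (fun t => M * `|P t|)) => //.
  - by move=> n; exact: measurable_funM.
  - exact: measurable_funM.
  - by apply: leb_ae_sub aestep => t ht Dt; apply: cvgM; [exact: ht|exact: cvg_cst].
  - by apply: integrable_scale => //; exact: integrable_norm iP.
  - by apply: aeW => t Dt n; rewrite normrM ler_wpM2r.
rewrite -(cvg_lim (@Rhausdorff R) c1)//; apply: (cvg_lim (@Rhausdorff R)).
have -> : extension \o (fun n => step 0 T n H) =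
    (fun n => \int[mu]_(t in D) (step 0 T n H t * P t)).
  by apply/funext => n; exact: stepE.
exact: c2.
Qed.

End integral_representation.

(** * Pairings with densities *)

Section pairings.
Context (R : realType).
Local Notation leb := (@lebesgue_measure R).
Local Notation meas := {measure set (measurableTypeR R) -> \bar R}.
Implicit Types (mu : meas) (f u : R -> R) (x t M T : R).

Lemma measurable_Omega : measurable (Omega : set (measurableTypeR R)).
Proof. exact: measurable_itv. Qed.
Local Hint Resolve measurable_Omega : core.

Lemma within_continuous_measurable f : {within `[-1, 1], continuous f} ->
  measurable_fun (Omega : set (measurableTypeR R)) f.
Proof.
move=> cf; have m11 : measurable_fun (`[-1, 1] : set (measurableTypeR R)) f.
  exact: subspace_continuous_measurable_fun.
by apply: measurable_funS m11 => //; exact: subset_itv_oo_cc.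
Qed.

Lemma lebesgue_Omega : leb Omega = 2%:E.
Proof.
rewrite /Omega lebesgue_measure_itv/= lte_fin ifT; last lra.
by rewrite -EFinD; congr EFin; lra.
Qed.

Lemma bounded_integrable (D : set (measurableTypeR R)) mu f M : measurable D ->
    (mu D < +oo)%E -> measurable_fun D f -> (forall x, D x -> `|f x| <= M) ->
  mu.-integrable D (EFin \o f).
Proof.
move=> mD fin mf fM; apply: measurable_bounded_integrable => //.
by exists M; split; [exact: num_real|move=> ? /ltW + ? ?; apply: le_trans; exact: fM].
Qed.

Lemma lebesgue_Omega_lty : (leb Omega < +oo)%E.
Proof. by rewrite lebesgue_Omega ltry. Qed.
Local Hint Resolve lebesgue_Omega_lty : core.

Lemma integrable_mul_bounded (D : set (measurableTypeR R)) (f h : R -> R) M : measurable D ->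
    leb.-integrable D (EFin \o f) -> measurable_fun D h ->
    (forall x, D x -> `|h x| <= M) ->
  leb.-integrable D (EFin \o (fun x => f x * h x)).
Proof.
move=> mD fi mh hM; have mf : measurable_fun D f.
  by case/integrableP : fi => /measurable_EFinP.
apply: (le_integrable mD _ _ (integrable_scale `|M| mD fi)) => //.
  by apply/measurable_EFinP; exact: measurable_funM.
move=> x Dx /=; rewrite lee_fin !normrM normr_id mulrC ler_wpM2r//.
exact: le_trans (hM x Dx) (ler_norm _).
Qed.

Lemma integrable_density mu u : is_density mu u -> leb.-integrable Omega (EFin \o u).
Proof.
move=> [mu_ u01 _]; apply/integrableP; split; first exact/measurable_EFinP.
apply: (@le_lt_trans _ _ (\int[leb]_(x in Omega) (cst 1%E x))%E); last first.
  by rewrite integral_cst// mul1e.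
apply: ae_ge0_le_integral => //.
- by apply: measurableT_comp => //; exact/measurable_EFinP.
- apply: leb_ae_sub u01 => x u01 Ox /=; have /andP[u0 u1] := u01 Ox.
  by rewrite ger0_norm// lee_fin.
Qed.

(** Both sides agree on step functions by the definition of a density, and both
    pass to the limit by dominated convergence. *)
Lemma pairing_density mu u f : Mset mu -> is_density mu u -> continuous f ->
  pairing mu f = \int[leb]_(x in Omega) (u x * f x).
Proof.
move=> [muC mu2] du cf; have [mu_ u01 muE] := du.
have iu := integrable_density du.
have mf (D : set R) : measurable_fun D f by apply: measurable_funTS; exact: continuous_measurable_fun.
have [M fM] : exists M, forall x, x \in `[(-1 : R), 1] -> `|f x| <= M.
  by apply: within_continuous_bounded; exact: continuous_subspaceT.
have n11 : (-1 : R) < 1 by lra.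
have fin : (mu Omega < +oo)%E by apply: le_lt_trans mu2 (ltry _).
pose s n := step (-1) 1 n f.
have sM n x : `|s n x| <= M by exact: normr_step_le.
have OM x : Omega x -> `|f x| <= M by move=> Ox; apply: fM; exact: subset_itv_oo_cc.
have ms n (D : set R) : measurable_fun D (s n) by apply: measurable_funTS; exact: measurable_step.
have sf x : Omega x -> (fun n => s n x) @ \oo --> f x.
  move=> Ox; apply: step_cvg => //; last by apply: cvg_at_right_filter; exact: cf.
  exact: subset_itv_oo_co.
have [_ c1] : mu.-integrable Omega (EFin \o f) /\
    (fun n => \int[mu]_(x in Omega) s n x) @ \oo --> \int[mu]_(x in Omega) f x.
  apply: (@Rdominated_cvg _ _ _ mu Omega s f (cst M)) => //.
  - by move=> n; exact: ms.
  - exact: mf.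
  - by apply: aeW => x Ox; exact: sf.
  - apply: (@bounded_integrable Omega mu (cst M) `|M|) => //.
  - by apply: aeW => x _ n; exact: sM.
have [_ c2] : leb.-integrable Omega (EFin \o (fun x => u x * f x)) /\
    (fun n => \int[leb]_(x in Omega) (u x * s n x)) @ \oo -->
    \int[leb]_(x in Omega) (u x * f x).
  apply: (@Rdominated_cvg _ _ _ leb Omega (fun n x => u x * s n x)
    (fun x => u x * f x) (fun x => M * `|u x|)) => //.
  - by move=> n; apply: measurable_funM => //; exact: ms.
  - by apply: measurable_funM => //; exact: mf.
  - by apply: aeW => x Ox; apply: cvgM; [exact: cvg_cst|exact: sf].
  - by apply: integrable_scale => //; exact: integrable_norm iu.
  - by apply: aeW => x Ox n; rewrite normrM mulrC ler_wpM2r.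
rewrite /pairing -(cvg_lim (@Rhausdorff R) c1) -(cvg_lim (@Rhausdorff R) c2).
congr (lim (_ @ \oo)); apply/funext => n.
have icell i : mu.-integrable Omega (EFin \o \1_(cell (-1) 1 n i)).
  apply: (@bounded_integrable _ _ _ 1) => //.
    by apply: measurable_indic; exact: measurable_cell.
  by move=> x _; rewrite indicE; case: (_ \in _); rewrite ?normr1 ?normr0.
have icell' i : leb.-integrable Omega (EFin \o (fun x => u x * \1_(cell (-1) 1 n i) x)).
  apply: (@integrable_mul_bounded _ _ _ 1) => //.
    by apply: measurable_indic; exact: measurable_cell.
  by move=> x _; rewrite indicE; case: (_ \in _); rewrite ?normr1 ?normr0.
transitivity (\sum_(i < n.+1) f (node (-1) 1 n i.+1) * \int[mu]_(x in Omega) \1_(cell (-1) 1 n i) x).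
  rewrite /s /step.
  rewrite (Rintegral_sum _ measurable_Omega
    (fun i : 'I_n.+1 => integrable_scale (f (node (-1) 1 n i.+1)) measurable_Omega (icell i))).2.
  by apply: eq_bigr => i _; rewrite RintegralZl.
transitivity (\sum_(i < n.+1) f (node (-1) 1 n i.+1) *
    \int[leb]_(x in Omega) (u x * \1_(cell (-1) 1 n i) x)); last first.
  transitivity (\int[leb]_(x in Omega) \sum_(i < n.+1)
      f (node (-1) 1 n i.+1) * (u x * \1_(cell (-1) 1 n i) x)).
    rewrite (Rintegral_sum _ measurable_Omega
      (fun i : 'I_n.+1 => integrable_scale (f (node (-1) 1 n i.+1)) measurable_Omega (icell' i))).2.
    by apply: eq_bigr => i _; rewrite RintegralZl.
  apply: eq_Rintegral => x _; rewrite /s /step mulr_sumr.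
  by apply: eq_bigr => i _; rewrite mulrCA.
apply: eq_bigr => i _; congr (_ * _).
have mcell : measurable (cell (-1) 1 n i : set (measurableTypeR R)) by exact: measurable_cell.
rewrite /Rintegral integral_indic// muE; last exact: measurableI.
rewrite -setIA setIid setIC integral_mkcondr; congr fine.
apply: eq_integral => x _; rewrite patchE indicE.
by case: ifPn; rewrite ?mulr1 ?mulr0.
Qed.

Lemma pairing_bounded mu f M : Mset mu -> measurable_fun Omega f ->
  (forall x, Omega x -> `|f x| <= M) -> `|pairing mu f| <= 2 * `|M|.
Proof.
move=> [_ mu2] mf fM.
have fin : (mu Omega < +oo)%E by apply: le_lt_trans mu2 (ltry _).
apply: (@le_trans _ _ (\int[mu]_(x in Omega) (cst `|M| x))).
  apply: normr_Rintegral_le_ae => //.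
    by apply: (@bounded_integrable _ _ _ `|M|) => // x _; rewrite normr_id.
  by apply: aeW => x Ox; apply: le_trans (fM x Ox) (ler_norm _).
rewrite Rintegral_cst// mulrC ler_wpM2r//.
by rewrite -lee_fin fineK// ge0_fin_numE.
Qed.

(** A cadlag path is right-continuous when tested against a bounded continuous
    function. *)
Lemma measurable_pairing T (S : set meas) (pi_ : R -> meas) f : 0 < T ->
    cadlag T S pi_ -> {within Omega, continuous f} ->
    (exists K : R, forall x, Omega x -> `|f x| <= K) ->
  measurable_fun (`[0, T] : set (measurableTypeR R)) (fun t => pairing (pi_ t) f).
Proof.
move=> T0 [_ rc _] cf fK; apply: measurable_right_continuous => // t tT.
exact: rc.
Qed.

Lemma densityP T (pi_ : R -> meas) t : cadlag T M0set pi_ -> t \in `[0, T] ->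
  is_density (pi_ t) (density (pi_ t)).
Proof.
move=> [M0 _ _] tT; have [_ [g dg]] := M0 _ tT.
by rewrite /density; case: xgetP => [y _ //|/(_ g)].
Qed.

End pairings.

(** * Smooth bumps *)

Section bump_functions.
Context (R : realType).
Implicit Types (x y z p q c : R).

Lemma is_derive_addr (f h : R -> R) x df dh : is_derive x 1 f df ->
  is_derive x 1 h dh -> is_derive x 1 (fun t => f t + h t) (df + dh).
Proof. by move=> fd hd; exact: (@is_deriveD _ _ _ f h x 1 df dh fd hd). Qed.

Lemma is_derive_mulr (f h : R -> R) x df dh : is_derive x 1 f df ->
  is_derive x 1 h dh -> is_derive x 1 (fun t => f t * h t) (f x * dh + h x * df).
Proof. by move=> fd hd; exact: (@is_deriveM _ _ f h x 1 df dh fd hd). Qed.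

Lemma is_derive_comp (f h : R -> R) x df dh : is_derive (h x) 1 f df ->
  is_derive x 1 h dh -> is_derive x 1 (fun t => f (h t)) (df * dh).
Proof. by move=> fd hd; exact: (@is_derive1_comp _ f h x df dh fd hd). Qed.

Lemma is_derive_continuous (f : R -> R) x df : is_derive x 1 f df -> {for x, continuous f}.
Proof.
by move=> [fd _]; apply: differentiable_continuous; exact/derivable1_diffP.
Qed.

(** [pos3] is the cube of the positive part; writing the powers as products with
    [y] makes [pos2] and [pos3] differentiable by the product rule, except for
    [pos2] at 0. *)
Definition pos y : R := Num.max 0 y.
Definition pos2 y : R := y * pos y.
Definition pos3 y : R := y * pos2 y.

Lemma pos_le0 y : y <= 0 -> pos y = 0.
Proof. by move=> y0; exact/max_idPl. Qed.

Lemma pos_ge0 y : 0 <= y -> pos y = y.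
Proof. by move=> y0; exact/max_idPr. Qed.

Lemma pos_cont : continuous pos.
Proof.
move=> y; rewrite /pos; apply: (@continuous_max _ _ (cst 0) id); [exact: cvg_cst|exact: cvg_id].
Qed.

Lemma is_derive_pos2 y : is_derive y 1 pos2 (2 * pos y).
Proof.
have id1 : is_derive y 1 (@id R) 1 by exact: is_derive_id.
have [y0|y0|->] := ltgtP y 0.
- rewrite pos_le0 ?ltW// mulr0.
  refine (near_eq_is_derive _ (is_derive_cst (0 : R) y 1)).
  near=> z; rewrite /pos2 pos_le0 ?mulr0//.
  by apply: ltW; near: z; exact: lt_nbhsl.
- have dsq : is_derive y 1 (fun t => t * t) (2 * pos y).
    by have := is_derive_mulr id1 id1; rewrite mulr1 pos_ge0 ?ltW// mulr_natl mulr2n.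
  refine (near_eq_is_derive _ dsq).
  near=> z; rewrite /pos2 pos_ge0//.
  by apply: ltW; near: z; exact: lt_nbhsr.
- rewrite pos_le0// mulr0; apply/is_derive1_caratheodory; exists pos; split.
  + by move=> z; rewrite /pos2 mul0r !subr0 mulrC.
  + exact: pos_cont.
  + exact: pos_le0.
Unshelve. all: by end_near. Qed.

Lemma is_derive_pos3 y : is_derive y 1 pos3 (3 * pos2 y).
Proof.
have id1 : is_derive y 1 (@id R) 1 by exact: is_derive_id.
refine (is_derive_eq (is_derive_mulr id1 (is_derive_pos2 y)) _).
rewrite /pos2; ring.
Qed.

Lemma pos3_le0 y : y <= 0 -> pos3 y = 0.
Proof. by move=> y0; rewrite /pos3 /pos2 pos_le0// !mulr0. Qed.

Lemma pos3_ge0 y : 0 <= pos3 y.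
Proof.
have [y0|y0] := leP y 0; first by rewrite pos3_le0.
by rewrite /pos3 /pos2 pos_ge0; [nra|exact: ltW].
Qed.

Lemma pos3_ge1 y : 1 <= y -> 1 <= pos3 y.
Proof. by move=> y1; rewrite /pos3 /pos2 pos_ge0; [nra|lra]. Qed.

Lemma pos3_le1 y : y <= 1 -> pos3 y <= 1.
Proof.
move=> y1; have [y0|y0] := leP y 0; first by rewrite pos3_le0.
rewrite /pos3 /pos2 pos_ge0; last exact: ltW.
have y2 : y * y <= 1 by nra.
by nra.
Qed.

(** A C^2 transition from 0 on the negative reals to 1 beyond 1. *)
Definition ramp y : R := 1 - pos3 (1 - pos3 y).
Definition dramp y : R := 9 * (pos2 (1 - pos3 y) * pos2 y).
Definition ddramp y : R := 9 * (pos2 (1 - pos3 y) * (2 * pos y) +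
  pos2 y * (2 * pos (1 - pos3 y) * - (3 * pos2 y))).

Lemma is_derive_onem (f : R -> R) x df : is_derive x 1 f df ->
  is_derive x 1 (fun t => 1 - f t) (- df).
Proof.
move=> fd; rewrite -[- df]sub0r.
exact: is_derive_subr (is_derive_cst (1 : R) x 1) fd.
Qed.

Lemma is_derive_ramp y : is_derive y 1 ramp (dramp y).
Proof.
have d1 := @is_derive_comp pos3 (fun t => 1 - pos3 t) y _ _
  (is_derive_pos3 (1 - pos3 y)) (is_derive_onem (is_derive_pos3 y)).
refine (is_derive_eq (is_derive_onem d1) _); rewrite /dramp; ring.
Qed.

Lemma is_derive_dramp y : is_derive y 1 dramp (ddramp y).
Proof.
have d1 := @is_derive_comp pos2 (fun t => 1 - pos3 t) y _ _
  (is_derive_pos2 (1 - pos3 y)) (is_derive_onem (is_derive_pos3 y)).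
exact: (is_derive_scaler 9 (is_derive_mulr d1 (is_derive_pos2 y))).
Qed.

Lemma ddramp_cont : continuous ddramp.
Proof.
have p2c : continuous pos2 by move=> y; exact: is_derive_continuous (is_derive_pos2 y).
have p3c : continuous pos3 by move=> y; exact: is_derive_continuous (is_derive_pos3 y).
have oc : continuous (fun y => 1 - pos3 y) by move=> y; apply: cvgB; [exact: cvg_cst|exact: p3c].
have c2 c (f : R -> R) : continuous f -> continuous (fun y => c * f y).
  by move=> fc y; apply: cvgM; [exact: cvg_cst|exact: fc].
apply: (c2 9) => y; apply: cvgD.
  apply: cvgM; last exact: (c2 2 _ pos_cont).
  by apply: (@continuous_comp _ _ _ (fun y => 1 - pos3 y) pos2); [exact: oc|exact: p2c].
apply: cvgM; first exact: p2c.
apply: cvgM; last by apply: cvgN; exact: (c2 3 _ p2c).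
apply: cvgM; first exact: cvg_cst.
by apply: (@continuous_comp _ _ _ (fun y => 1 - pos3 y) pos); [exact: oc|exact: pos_cont].
Qed.

Lemma ramp_le0 y : y <= 0 -> ramp y = 0.
Proof.
move=> y0; rewrite /ramp (pos3_le0 y0) subr0 /pos3 /pos2 pos_ge0// !mulr1 subrr//.
Qed.

Lemma ramp_ge1 y : 1 <= y -> ramp y = 1.
Proof. by move=> /pos3_ge1 y1; rewrite /ramp pos3_le0 ?subr0//; lra. Qed.

Lemma ramp_itv y : 0 <= ramp y <= 1.
Proof.
have := pos3_ge0 (1 - pos3 y).
have := @pos3_le1 (1 - pos3 y); have := pos3_ge0 y; rewrite /ramp; lra.
Qed.

Definition slope p q n x : R := n.+1%:R * ((x - p) * (q - x)) - 1.
Definition dslope p q n x : R := n.+1%:R * (p + q - 2 * x).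

(** The shift by 1 in [slope] keeps the support of the bump at a positive distance
    from [p] and [q], so that it is compact in the open interval. *)
Definition bump p q n x : R := ramp (slope p q n x).
Definition dbump p q n x : R := dramp (slope p q n x) * dslope p q n x.
Definition ddbump p q n x : R :=
  dramp (slope p q n x) * (n.+1%:R * - 2) +
  dslope p q n x * (ddramp (slope p q n x) * dslope p q n x).

Lemma is_derive_slope p q n x : is_derive x 1 (slope p q n) (dslope p q n x).
Proof.
have id1 : is_derive x 1 (@id R) 1 by exact: is_derive_id.
have d1 : is_derive x 1 (fun t => t - p) (1 - 0).
  exact: is_derive_subr id1 (is_derive_cst p x 1).
have d2 : is_derive x 1 (fun t => q - t) (0 - 1).
  exact: is_derive_subr (is_derive_cst q x 1) id1.
refine (is_derive_eq (is_derive_subr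
  (is_derive_scaler n.+1%:R (is_derive_mulr d1 d2)) (is_derive_cst (1 : R) x 1)) _).
rewrite /dslope; ring.
Qed.

Lemma is_derive_dslope p q n x : is_derive x 1 (dslope p q n) (n.+1%:R * - 2).
Proof.
have id1 : is_derive x 1 (@id R) 1 by exact: is_derive_id.
refine (is_derive_eq (is_derive_scaler n.+1%:R
  (is_derive_subr (is_derive_cst (p + q) x 1) (is_derive_scaler 2 id1))) _).
by rewrite mulr1 sub0r.
Qed.

Lemma is_derive_bump p q n x : is_derive x 1 (bump p q n) (dbump p q n x).
Proof. exact: is_derive_comp (is_derive_ramp _) (is_derive_slope p q n x). Qed.

Lemma is_derive_dbump p q n x : is_derive x 1 (dbump p q n) (ddbump p q n x).
Proof.
exact: is_derive_mulr (is_derive_comp (is_derive_dramp _) (is_derive_slope p q n x))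
  (is_derive_dslope p q n x).
Qed.

Lemma bump_cont p q n : continuous (bump p q n).
Proof. by move=> x; exact: is_derive_continuous (is_derive_bump p q n x). Qed.

Lemma dbump_cont p q n : continuous (dbump p q n).
Proof. by move=> x; exact: is_derive_continuous (is_derive_dbump p q n x). Qed.

Lemma ddbump_cont p q n : continuous (ddbump p q n).
Proof.
have sc : continuous (slope p q n).
  by move=> x; exact: is_derive_continuous (is_derive_slope p q n x).
have dsc : continuous (dslope p q n).
  by move=> x; exact: is_derive_continuous (is_derive_dslope p q n x).
have drc : continuous dramp.
  by move=> x; exact: is_derive_continuous (is_derive_dramp x).
move=> x; apply: cvgD.
  apply: cvgM; last exact: cvg_cst.
  by apply: (@continuous_comp _ _ _ (slope p q n) dramp); [exact: sc|exact: drc].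
apply: cvgM; first exact: dsc.
apply: cvgM; last exact: dsc.
by apply: (@continuous_comp _ _ _ (slope p q n) ddramp); [exact: sc|exact: ddramp_cont].
Qed.

Lemma bump_itv p q n x : 0 <= bump p q n x <= 1.
Proof. exact: ramp_itv. Qed.

Lemma bump_support p q n x : p < q -> bump p q n x != 0 ->
  p + (n.+1%:R * (q - p))^-1 <= x <= q - (n.+1%:R * (q - p))^-1.
Proof.
move=> pq; have [s0|s0 _] := leP (slope p q n x) 0.
  by rewrite /bump ramp_le0// eqxx.
have n0 : 0 < n.+1%:R :> R by [].
set N : R := n.+1%:R in n0 *.
have qp : 0 < q - p by rewrite subr_gt0.
have {s0}s0 : 1 < N * ((x - p) * (q - x)) by move: s0; rewrite /slope -/N; lra.
have pos : 0 < (x - p) * (q - x) by rewrite -(pmulr_rgt0 _ n0); lra.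
have /andP[px xq] : p < x < q by nra.
have Nqp : 0 < N * (q - p) by rewrite mulr_gt0.
have e1 : (N * (q - p))^-1 <= x - p.
  by rewrite -[leLHS]mul1r ler_pdivrMr//; nra.
have e2 : (N * (q - p))^-1 <= q - x.
  by rewrite -[leLHS]mul1r ler_pdivrMr//; nra.
move: e1 e2; set e := (N * (q - p))^-1 => e1 e2.
by apply/andP; split; clearbody e; lra.
Qed.

Lemma bump_cvg1 p q x : x \in `]p, q[ -> (fun n => bump p q n x) @ \oo --> (1 : R).
Proof.
rewrite in_itv/= => /andP[px xq].
have pos : 0 < (x - p) * (q - x) by rewrite mulr_gt0 ?subr_gt0.
apply: cvg_near_cst.
have e0 : 0 < (x - p) * (q - x) / 2 by rewrite divr_gt0.
have := near_infty_natSinv_lt (PosNum e0); apply: filterS => n /= ne.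
apply: ramp_ge1; rewrite /slope.
have n0 : 0 < n.+1%:R :> R by [].
move: ne; rewrite -[X in X < _]mul1r ltr_pdivrMr// ; nra.
Qed.

End bump_functions.

(** * Test functions in time and space *)

Section test_functions.
Context (R : realType).
Implicit Types (x t c T : R) (g : R -> R).

Lemma within_rect_fst T g : {within `[0, T], continuous g} ->
  {within rect T, continuous (fun p : R * R => g p.1)}.
Proof.
move=> cg; apply/subspace_continuousP => p [/= p1 p2].
have /subspace_continuousP/(_ _ p1) gp := cg.
apply: cvg_trans gp => A /= gA.
have : within `[0, T] (nbhs p.1) (g @^-1` A) by exact: gA.
rewrite /within/= => near1.
have : \forall q \near p, `[0, T]%classic q.1 -> A (g q.1) by exact: (cvg_fst near1).
by apply: filterS => q qA [/= q1 _]; exact: qA.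
Qed.

Lemma within_rect_snd T g : {within `[-1, 1], continuous g} ->
  {within rect T, continuous (fun p : R * R => g p.2)}.
Proof.
move=> cg; apply/subspace_continuousP => p [/= p1 p2].
have /subspace_continuousP/(_ _ p2) gp := cg.
apply: cvg_trans gp => A /= gA.
have : within `[-1, 1] (nbhs p.2) (g @^-1` A) by exact: gA.
rewrite /within/= => near2.
have : \forall q \near p, `[-1, 1]%classic q.2 -> A (g q.2) by exact: (cvg_snd near2).
by apply: filterS => q qA [/= _ q2]; exact: qA.
Qed.

Lemma within_rect_mul T (f h : R * R -> R) :
  {within rect T, continuous f} -> {within rect T, continuous h} ->
  {within rect T, continuous (fun p => f p * h p)}.
Proof. by move=> cf ch p; apply: cvgM; [exact: cf|exact: ch]. Qed.

Lemma within_rect_sum T (I : Type) (s : seq I) (f : I -> R * R -> R) :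
  (forall i, {within rect T, continuous (f i)}) ->
  {within rect T, continuous (fun p => \sum_(i <- s) f i p)}.
Proof.
move=> cf; elim: s => [|i s IH].
  by under eq_fun do rewrite big_nil; move=> p; exact: cvg_cst.
under eq_fun do rewrite big_cons.
by move=> p; apply: cvgD; [exact: cf|exact: IH].
Qed.

Lemma is_derive1P g x : derivable g x 1 -> is_derive x 1 g (derive1 g x).
Proof. by move=> gd; rewrite derive1E; exact: derivableP. Qed.

Lemma derive1_is_derive g x dg : is_derive x 1 g dg -> derive1 g x = dg.
Proof. by case=> _ gE; rewrite derive1E. Qed.

Lemma is_derive_mulr_cst g c x dg : is_derive x 1 g dg ->
  is_derive x 1 (fun t => g t * c) (dg * c).
Proof.
move=> gd; rewrite mulrC (_ : (fun t => g t * c) = (fun t => c * g t)).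
  exact: is_derive_scaler.
by apply/funext => t; rewrite mulrC.
Qed.

Lemma C11_mul T (H g : R -> R) : C1 0 T H -> C1 (-1) 1 g ->
  C11 T (fun t x => H t * g x).
Proof.
move=> [Hc Hd [h ch Hh]] [gc gd [k ck gk]]; split.
- by apply: within_rect_mul; [exact: within_rect_fst|exact: within_rect_snd].
- move=> p [/= p1 p2]; split.
    by have [] := is_derive_mulr_cst (g p.2) (is_derive1P (Hd _ p1)).
  by have [] := is_derive_scaler (H p.1) (is_derive1P (gd _ p2)).
- exists (fun p => h p.1 * g p.2).
    by apply: within_rect_mul; [exact: within_rect_fst|exact: within_rect_snd].
  move=> p [/= p1 p2]; rewrite /dt -Hh//.
  exact: derive1_is_derive (is_derive_mulr_cst (g p.2) (is_derive1P (Hd _ p1))).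
- exists (fun p => H p.1 * k p.2).
    by apply: within_rect_mul; [exact: within_rect_fst|exact: within_rect_snd].
  move=> p [/= p1 p2]; rewrite /dx -gk//.
  exact: derive1_is_derive (is_derive_scaler (H p.1) (is_derive1P (gd _ p2))).
Qed.

Lemma is_derive_big (I : Type) (s : seq I) (f df : I -> R -> R) x :
  (forall i, is_derive x 1 (f i) (df i x)) ->
  is_derive x 1 (fun y => \sum_(i <- s) f i y) (\sum_(i <- s) df i x).
Proof.
move=> fd; elim: s => [|i s IH].
  have -> : (fun y => \sum_(i <- [::]) f i y) = (cst 0).
    by apply/funext => y; rewrite big_nil.
  by rewrite big_nil; exact: is_derive_cst.
have -> : (fun y => \sum_(j <- i :: s) f j y) = (fun y => f i y + \sum_(j <- s) f j y).
  by apply/funext => y; rewrite big_cons.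
by rewrite big_cons; exact: is_derive_addr (fd i) IH.
Qed.

(** The factors [H i] are only differentiable inside [0,T], whereas the [f i] are
    C^2 on the whole line, so the space derivatives are computed globally and the
    time derivative only in the interior. *)
Lemma C12c_sum T (n : nat) (H : nat -> R -> R) (f f1 f2 : nat -> R -> R) (al be : R) :
    0 < T -> -1 < al -> be < 1 ->
    (forall i, C1 0 T (H i)) ->
    (forall i x, is_derive x 1 (f i) (f1 i x)) ->
    (forall i x, is_derive x 1 (f1 i) (f2 i x)) ->
    (forall i, continuous (f2 i)) ->
    (forall i x, (i < n)%N -> f i x != 0 -> al <= x <= be) ->
  let G t x := \sum_(i < n) H i t * f i x in
  C12c T G /\ forall t x, dx G t x = \sum_(i < n) H i t * f1 i x.
Proof.
move=> T0 al1 be1 H1 fd f1d f2c fs G.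
have Gx t x : is_derive x 1 (G t) (\sum_(i < n) H i t * f1 i x).
  exact: (@is_derive_big _ _ (fun (i : 'I_n) y => H i t * f i y)
    (fun i y => H i t * f1 i y) x (fun i => is_derive_scaler (H i t) (fd i x))).
have dxE t x : dx G t x = \sum_(i < n) H i t * f1 i x.
  by rewrite /dx derive1E; have [_ ->] := Gx t x.
have dxE' : dx G = fun t x => \sum_(i < n) H i t * f1 i x.
  by apply/funext => t; apply/funext => x; exact: dxE.
have Gxx t x : is_derive x 1 (dx G t) (\sum_(i < n) H i t * f2 i x).
  rewrite dxE'.
  exact: (@is_derive_big _ _ (fun (i : 'I_n) y => H i t * f1 i y)
    (fun i y => H i t * f2 i y) x (fun i => is_derive_scaler (H i t) (f1d i x))).
have dHt i t : t \in `]0, T[ -> is_derive t 1 (H i) (derive1 (H i) t).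
  by have [_ Hd _] := H1 i => tT; rewrite derive1E; apply: derivableP; exact: Hd.
have Gt t x : t \in `]0, T[ ->
    is_derive t 1 (G ^~ x) (\sum_(i < n) derive1 (H i) t * f i x).
  move=> tT.
  exact: (@is_derive_big _ _ (fun (i : 'I_n) s => H i s * f i x)
    (fun i s => derive1 (H i) s * f i x) t
    (fun i => is_derive_mulr_cst (f i x) (dHt i t tT))).
have /choice[h hP] : forall i, exists hi : R -> R,
    {within `[0, T], continuous hi} /\
    forall t, t \in `]0, T[ -> derive1 (H i) t = hi t.
  by move=> i; have [_ _ [hi hc hE]] := H1 i; exists hi.
have fc i : continuous (f i) by move=> x; exact: is_derive_continuous (fd i x).
have f1c i : continuous (f1 i) by move=> x; exact: is_derive_continuous (f1d i x).
have sumc (a b : nat -> R -> R) : (forall i, {within `[0, T], continuous (a i)}) ->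
    (forall i, continuous (b i)) ->
    {within rect T, continuous (fun p => \sum_(i < n) a i p.1 * b i p.2)}.
  move=> ca cb; apply: (@within_rect_sum _ _ _ (fun (i : 'I_n) p => a i p.1 * b i p.2)) => i.
  apply: within_rect_mul; first exact: within_rect_fst.
  by apply: within_rect_snd; exact: continuous_subspaceT.
have Hc i : {within `[0, T], continuous (H i)} by have [] := H1 i.
have suppG : supp T G `<=` `[0, T] `*` `[al, be].
  rewrite /supp closureE; apply: smallest_sub.
    apply: compact_closed; first exact: norm_hausdorff.
    by apply: compact_setX; exact: segment_compact.
  move=> p [[p1 _] Gp]; split => //=; rewrite in_itv/=.
  have [i fi] : exists i : 'I_n, f i p.2 != 0.
    apply: contrapT => nofi; move/eqP: Gp; apply; rewrite /G big1// => i _.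
    have [->|fi] := eqVneq (f i p.2) 0; first by rewrite mulr0.
    by exfalso; apply: nofi; exists i.
  exact: (fs i p.2 (ltn_ord i) fi).
split => //; split.
- split; [split| |].
  + exact: sumc.
  + move=> p [/= p1 p2]; split; first by have [] := Gt p.1 p.2 p1.
    by have [] := Gx p.1 p.2.
  + exists (fun p => \sum_(i < n) h i p.1 * f i p.2).
      by apply: sumc => // i; have [] := hP i.
    move=> p [/= p1 p2]; rewrite /dt (derive1_is_derive (Gt p.1 p.2 p1)).
    by apply: eq_bigr => i _; have [_ ->] := hP i.
  + exists (fun p => \sum_(i < n) H i p.1 * f1 i p.2); first exact: sumc.
    by move=> p _; exact: dxE.
  + by move=> p _; have [] := Gxx p.1 p.2.
  + exists (fun p => \sum_(i < n) H i p.1 * f2 i p.2); first exact: sumc.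
    by move=> p _; exact: derive1_is_derive (Gxx p.1 p.2).
- apply: (subclosed_compact _ _ suppG); first exact: closed_closure.
  by apply: compact_setX; exact: segment_compact.
- apply: subset_trans suppG _ => p [p1]; rewrite /= in_itv/= => /andP[alp bep].
  split => //=; rewrite /Omega/= in_itv/=.
  by rewrite (lt_le_trans al1 alp) (le_lt_trans bep be1).
Qed.

End test_functions.

(** * Weak derivatives controlled by pairings *)

Section limn_einf_comparison.
Context (R : realType).
Implicit Types (u v : nat -> \bar R).

Lemma le_limn_einf u v : (forall n, (u n <= v n)%E) -> (limn_einf u <= limn_einf v)%E.
Proof.
move=> uv; rewrite !limn_einf_lim; apply: lee_lim.
- by apply: ereal_nondecreasing_is_cvgn; exact: nondecreasing_einfs.
- by apply: ereal_nondecreasing_is_cvgn; exact: nondecreasing_einfs.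
- apply: nearW => n; apply: le_ereal_inf_tmp => _ [m /= nm <-].
  by apply: le_trans (uv m); apply: ereal_inf_lbound; exists m.
Qed.

Lemma measurable_fun_fine : measurable_fun [set: \bar R] (@fine R).
Proof.
move=> _ B mB; rewrite setTI.
have [B0|B0] := pselect (B 0).
  exists B => //; exists [set -oo; +oo]%E; first by constructor.
  apply/seteqP; split=> [_ [[r Br <-]|[->|->]]|] //= [r| |] /= Br; first by left; exists r.
    by right; right.
  by right; left.
exists B => //; exists set0; first by constructor.
rewrite setU0; apply/seteqP; split=> [_ [r Br <-]|] //= [r| |] //= Br.
by exists r.
Qed.

Lemma measurable_limn_einf d (X : measurableType d) (D : set X) (f : nat -> X -> \bar R) :
  (forall n, measurable_fun D (f n)) -> measurable_fun D (fun x => limn_einf (f ^~ x)).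
Proof.
move=> mf; rewrite /limn_einf; apply: measurableT_comp => //.
by apply: measurable_fun_limn_esup => n; exact: measurableT_comp.
Qed.

Lemma cvg_le_limn_einf (a : nat -> R) (l : R) u : a @ \oo --> l ->
  (forall n, ((a n)%:E <= u n)%E) -> (l%:E <= limn_einf u)%E.
Proof.
move=> al au; apply: le_trans (le_limn_einf au).
have /cvg_limn_einf_sup[-> _] // : (fun n => (a n)%:E) @ \oo --> l%:E.
by apply/fine_cvgP; split => //; exact: nearW.
Qed.

Lemma limn_einf_cst (M : \bar R) : limn_einf (fun=> M) = M.
Proof.
by have /cvg_limn_einf_sup[] : (fun _ : nat => M) @ \oo --> M by exact: cvg_cst.
Qed.

End limn_einf_comparison.

Section weak_derivative_bound.
Context (R : realType).
Local Notation leb := (@lebesgue_measure R).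
Implicit Types (f h u w : R -> R) (x p q C : R).

Lemma test_fun_bump p q n : -1 <= p -> p < q -> q <= 1 -> test_fun (bump p q n).
Proof.
move=> p1 pq q1.
have dE : derive1 (bump p q n) = dbump p q n.
  by apply/funext => x; exact: derive1_is_derive (is_derive_bump p q n x).
have e0 : 0 < (n.+1%:R * (q - p))^-1 by rewrite invr_gt0 mulr_gt0// subr_gt0.
set e := (_)^-1 in e0.
have sub : closure [set x | bump p q n x != 0] `<=` `[p + e, q - e].
  rewrite closureE; apply: smallest_sub; first exact: itv_closed.
  by move=> x /= /(bump_support pq); rewrite in_itv.
split.
- by move=> x; have [] := is_derive_bump p q n x.
- by rewrite dE; exact: dbump_cont.
- apply: (subclosed_compact _ _ sub); first exact: closed_closure.
  exact: segment_compact.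
- apply: subset_trans sub _ => x; rewrite /Omega/= !in_itv/= => /andP[px xq].
  by clearbody e; apply/andP; split; lra.
Qed.

(** The grid is that of [step], on the interval from -1 to 1. *)
Definition cell_bump n i j : R -> R := bump (node (-1) 1 n i) (node (-1) 1 n i.+1) j.
Definition cell_dbump n i j : R -> R := dbump (node (-1) 1 n i) (node (-1) 1 n i.+1) j.

(** For [F h = int u h] with [u] weakly differentiable, this is the squared L^2
    norm of the projection of the derivative of [u] on the step functions, up to
    replacing the indicators of the cells by bumps. *)
Definition discrete_energy (F : (R -> R) -> R) n j : R :=
  \sum_(i < n.+1) F (cell_dbump n i j) ^+ 2 / mesh (-1) 1 n.

Definition relaxed_energy (F : (R -> R) -> R) : \bar R :=
  limn_einf (fun n => limn_einf (fun j => (discrete_energy F n j)%:E)).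

Let n11 : (-1 : R) < 1. Proof. lra. Qed.

Lemma node_itv n i : (i <= n.+1)%N -> -1 <= node (-1 : R) 1 n i <= 1.
Proof.
move=> ni; have := le_node n n11 (leq0n i); rewrite node0 => ->/=.
by have := le_node n n11 ni; rewrite node_last.
Qed.

Lemma ltr_nodeS n i : node (-1 : R) 1 n i < node (-1) 1 n i.+1.
Proof. by rewrite nodeS ltrDl mesh_gt0. Qed.

Lemma cell_bump_test n i j : (i < n.+1)%N -> test_fun (cell_bump n i j).
Proof.
move=> ni; have /andP[p1 _] := node_itv (ltnW ni); have /andP[_ q1] := node_itv ni.
by apply: test_fun_bump => //; exact: ltr_nodeS.
Qed.

Lemma cell_bump_cvg n i x : x != node (-1) 1 n i ->
  (fun j => cell_bump n i j x) @ \oo --> (\1_(cell (-1) 1 n i) x : R).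
Proof.
move=> xi; rewrite indicE; case: (boolP (x \in _)) => [/set_mem|xcell].
  rewrite /cell/= in_itv/= le_eqVlt eq_sym (negbTE xi)/= => xc.
  by apply: bump_cvg1; rewrite in_itv.
apply: cvg_near_cst; apply: nearW => j; apply/eqP; apply: contraTT xcell => /=.
move=> /(bump_support (ltr_nodeS n i)); rewrite negbK => /andP[px xq].
apply/mem_set; rewrite /cell/= in_itv/=.
have : 0 < (j.+1%:R * (node (-1) 1 n i.+1 - node (-1) 1 n i))^-1 :> R.
  by rewrite invr_gt0 mulr_gt0// subr_gt0 ltr_nodeS.
move: px xq; set e := (_)^-1 => px xq e0; clearbody e.
by apply/andP; split; lra.
Qed.

Lemma weak_deriv_integrable u w : is_weak_deriv u w -> leb.-integrable Omega (EFin \o w).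
Proof.
move=> [mw iw2 _]; have mO := @measurable_Omega R.
have i1 : leb.-integrable Omega (EFin \o (cst (1 : R))).
  by apply: (@bounded_integrable R Omega leb (cst 1) 1) => //;
    [exact: lebesgue_Omega_lty|move=> x _; rewrite normr1].
apply: (le_integrable mO _ _ (integrableD mO i1 iw2)).
  exact/measurable_EFinP.
move=> x Ox /=; rewrite lee_fin [leRHS]ger0_norm; last by rewrite addr_ge0// sqr_ge0.
rewrite -(real_normK (num_real (w x))).
have := sqr_ge0 (`|w x| - 1); have := normr_ge0 (w x).
set y := `|w x|; nra.
Qed.

(** On step functions [f] with values [f_i], the pairing with [w] is the limit of
    [- sum_i f_i F(phi_i')], and [2 |f_i F_i| <= f_i^2 d + F_i^2 / d].  The first
    terms sum up to at most [2 C^2], as the cells have total length 2. *)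
Lemma weak_deriv_continuous_bound u w f C : is_weak_deriv u w ->
    {within `[-1, 1], continuous f} -> (forall x, x \in `[-1, 1] -> `|f x| <= C) ->
  ((2 * (`|\int[leb]_(x in Omega) (w x * f x)| - C ^+ 2))%:E <=
    relaxed_energy (fun h => \int[leb]_(x in Omega) (u x * h x))%R)%E.
Proof.
move=> wd cf fC; have mO := @measurable_Omega R.
have iw := weak_deriv_integrable wd; have [mw _ wP] := wd.
have sC n x : `|step (-1) 1 n f x| <= C by apply: normr_step_le => // *; exact: fC.
have mstep n : measurable_fun Omega (step (-1) 1 n f).
  by apply: measurable_funTS; exact: measurable_step.
have [_ c1] : leb.-integrable Omega (EFin \o (fun x => w x * f x)) /\
    (fun n => \int[leb]_(x in Omega) (w x * step (-1) 1 n f x)) @ \oo -->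
    \int[leb]_(x in Omega) (w x * f x).
  apply: (@Rdominated_cvg _ _ _ leb Omega (fun n x => w x * step (-1) 1 n f x)
    (fun x => w x * f x) (fun x => C * `|w x|)) => //.
  - by move=> n; apply: measurable_funM => //; exact: mstep.
  - by apply: measurable_funM => //; exact: within_continuous_measurable.
  - apply: aeW => x Ox; apply: cvgM; first exact: cvg_cst.
    apply: step_cvg => //; first exact: subset_itv_oo_co.
    by apply: cvg_at_right_filter; exact: within_continuous_continuous Ox.
  - by apply: integrable_scale => //; exact: integrable_norm iw.
  - by apply: aeW => x Ox n; rewrite normrM mulrC ler_wpM2r.
have c1' : (fun n => 2 * (`|\int[leb]_(x in Omega) (w x * step (-1) 1 n f x)| - C ^+ 2)) @ \oo -->
    2 * (`|\int[leb]_(x in Omega) (w x * f x)| - C ^+ 2).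
  apply: cvgM; first exact: cvg_cst.
  by apply: cvgB; [exact: cvg_norm c1|exact: cvg_cst].
apply: (cvg_le_limn_einf c1') => n.
have fnode (i : 'I_n.+1) : `|f (node (-1) 1 n i.+1)| <= C.
  by apply: fC; rewrite in_itv/=; exact: node_itv.
pose b j x := \sum_(i < n.+1) f (node (-1) 1 n i.+1) * cell_bump n i j x.
have bump01 i j x : `|cell_bump n i j x| <= 1.
  by have /andP[b0 b1] := bump_itv (node (-1) 1 n i) (node (-1) 1 n i.+1) j x; rewrite ger0_norm.
have mbump i j : measurable_fun Omega (cell_bump n i j).
  by apply: measurable_funTS; apply: continuous_measurable_fun; exact: bump_cont.
have [_ c2] : leb.-integrable Omega (EFin \o (fun x => w x * step (-1) 1 n f x)) /\
    (fun j => \int[leb]_(x in Omega) (w x * b j x)) @ \oo -->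
    \int[leb]_(x in Omega) (w x * step (-1) 1 n f x).
  apply: (@Rdominated_cvg _ _ _ leb Omega (fun j x => w x * b j x)
    (fun x => w x * step (-1) 1 n f x) (fun x => (n.+1%:R * C) * `|w x|)) => //.
  - move=> j; apply: measurable_funM => //; apply: measurable_sum => i.
    by apply: measurable_funM; [exact: measurable_cst|exact: mbump].
  - by apply: measurable_funM => //; exact: mstep.
  - have : \forall x \ae leb, forall i, x != node (-1) 1 n i.
      by apply/ae_foralln => i; exact: leb_ae_neq.
    apply: leb_ae_sub => x xn Ox; apply: cvgM; first exact: cvg_cst.
    apply: (@cvg_sumr _ _ _ (fun (i : 'I_n.+1) j => f (node (-1) 1 n i.+1) * cell_bump n i j x)
      (fun i : 'I_n.+1 => f (node (-1) 1 n i.+1) * \1_(cell (-1) 1 n i) x)) => i.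
    by apply: cvgM; [exact: cvg_cst|exact: cell_bump_cvg].
  - by apply: integrable_scale => //; exact: integrable_norm iw.
  - apply: aeW => x Ox j; rewrite normrM mulrC ler_wpM2r//.
    apply: le_trans (ler_norm_sum _ _ _) _.
    apply: (@le_trans _ _ (\sum_(i < n.+1) C)); last first.
      by rewrite sumr_const card_ord mulr_natl.
    apply: ler_sum => i _; rewrite normrM -[leRHS]mulr1.
    by apply: ler_pM.
have c2' : (fun j => 2 * (`|\int[leb]_(x in Omega) (w x * b j x)| - C ^+ 2)) @ \oo -->
    2 * (`|\int[leb]_(x in Omega) (w x * step (-1) 1 n f x)| - C ^+ 2).
  apply: cvgM; first exact: cvg_cst.
  by apply: cvgB; [exact: cvg_norm c2|exact: cvg_cst].
apply: (cvg_le_limn_einf c2') => j; rewrite lee_fin.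
have icell (i : 'I_n.+1) : leb.-integrable Omega (EFin \o (fun x => w x * cell_bump n i j x)).
  apply: (@integrable_mul_bounded _ _ _ _ 1); [exact: mO|exact: iw|exact: mbump|].
  by move=> x _; exact: bump01.
have -> : \int[leb]_(x in Omega) (w x * b j x) =
    \sum_(i < n.+1) f (node (-1) 1 n i.+1) * \int[leb]_(x in Omega) (w x * cell_bump n i j x).
  transitivity (\int[leb]_(x in Omega) \sum_(i < n.+1)
      f (node (-1) 1 n i.+1) * (w x * cell_bump n i j x)).
    apply: eq_Rintegral => x _; rewrite /b mulr_sumr.
    by apply: eq_bigr => i _; rewrite mulrCA.
  rewrite (Rintegral_sum _ mO
    (fun i : 'I_n.+1 => integrable_scale (f (node (-1) 1 n i.+1)) mO (icell i))).2.
  by apply: eq_bigr => i _; rewrite RintegralZl.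
have d0 : 0 < mesh (-1 : R) 1 n by exact: mesh_gt0.
rewrite /discrete_energy.
under [X in _ <= X]eq_bigr => i _.
  have -> : \int[leb]_(x in Omega) (u x * cell_dbump n i j x) =
      - \int[leb]_(x in Omega) (w x * cell_bump n i j x).
    rewrite -(wP _ (cell_bump_test _ (ltn_ord i))); apply: eq_Rintegral => x _.
    by rewrite (derive1_is_derive (is_derive_bump _ _ _ x)).
  rewrite sqrrN; over.
have -> : C ^+ 2 = \sum_(i < n.+1) (C ^+ 2 * mesh (-1) 1 n / 2).
  rewrite sumr_const card_ord /mesh -mulr_natl.
  have : n.+1%:R != 0 :> R by rewrite pnatr_eq0.
  by move=> ?; field.
apply: (@le_trans _ _ (\sum_(i < n.+1) (2 * (`|f (node (-1) 1 n i.+1)| *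
   `|\int[leb]_(x in Omega) (w x * cell_bump n i j x)|) - C ^+ 2 * mesh (-1) 1 n))).
  have -> : \sum_(i < n.+1) (2 * (`|f (node (-1) 1 n i.+1)| *
      `|\int[leb]_(x in Omega) (w x * cell_bump n i j x)|) - C ^+ 2 * mesh (-1) 1 n) =
    2 * (\sum_(i < n.+1) `|f (node (-1) 1 n i.+1)| *
      `|\int[leb]_(x in Omega) (w x * cell_bump n i j x)| -
      \sum_(i < n.+1) (C ^+ 2 * mesh (-1) 1 n / 2)).
    by rewrite -sumrB mulr_sumr; apply: eq_bigr => i _; field.
  rewrite ler_pM2l// lerD2r; apply: le_trans (ler_norm_sum _ _ _) _.
  by apply: ler_sum => i _; rewrite normrM.
apply: ler_sum => i _.
set W := \int[leb]_(x in Omega) _; set a := f _; set d := mesh _ _ _ in d0 *.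
have aC : `|a| <= C by exact: fnode.
rewrite ler_pdivlMr// -(real_normK (num_real W)).
have := sqr_ge0 (`|W| - C * d).
have := normr_ge0 W; set V := `|W|; have := normr_ge0 a; set A := `|a| in aC *.
move=> A0 V0 sq; have := ler_wpM2r (mulr_ge0 V0 (ltW d0)) aC.
move: sq; clearbody V A d; nra.
Qed.

(** Approximate [f] boundedly by C^1 functions. *)
Lemma weak_deriv_bound u w f C : is_weak_deriv u w ->
    measurable_fun Omega f -> (forall x, Omega x -> `|f x| <= C) ->
  ((2 * (`|\int[leb]_(x in Omega) (w x * f x)| - C ^+ 2))%:E <=
    relaxed_energy (fun h => \int[leb]_(x in Omega) (u x * h x))%R)%E.
Proof.
move=> wd mf fC; have mO := @measurable_Omega R.
have iw := weak_deriv_integrable wd; have [mw _ _] := wd.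
have C0 : 0 <= C.
  have O0 : Omega (0 : R) by rewrite /Omega/= in_itv/=; apply/andP; split; lra.
  by apply: le_trans (fC 0 O0).
have mf' : measurable_fun setT (f \_ Omega) by exact/(measurable_restrictT _ _).1.
have fC' x : `|(f \_ Omega) x| <= C.
  by rewrite patchE; case: ifPn => [/set_mem/fC//|_]; rewrite normr0.
have [f_ [f1 f_C ff]] := C1_approximation (-1) 1 mf' fC'.
have mf_ n : measurable_fun Omega (f_ n).
  by apply: within_continuous_measurable; case: (f1 n).
have [_ c1] : leb.-integrable Omega (EFin \o (fun x => w x * f x)) /\
    (fun n => \int[leb]_(x in Omega) (w x * f_ n x)) @ \oo -->
    \int[leb]_(x in Omega) (w x * f x).
  apply: (@Rdominated_cvg _ _ _ leb Omega (fun n x => w x * f_ n x)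
    (fun x => w x * f x) (fun x => C * `|w x|)) => //.
  - by move=> n; apply: measurable_funM => //; exact: mf_.
  - exact: measurable_funM.
  - apply: leb_ae_sub ff => x fx Ox; apply: cvgM; first exact: cvg_cst.
    have := fx (subset_itv_oo_cc Ox); rewrite patchE mem_set//.
  - by apply: integrable_scale => //; exact: integrable_norm iw.
  - apply: aeW => x Ox n; rewrite normrM mulrC ler_wpM2r//.
    by apply: f_C; exact: subset_itv_oo_cc.
have le_n n : ((2 * (`|\int[leb]_(x in Omega) (w x * f_ n x)| - C ^+ 2))%:E <=
    relaxed_energy (fun h => \int[leb]_(x in Omega) (u x * h x))%R)%E.
  by apply: weak_deriv_continuous_bound => //; [case: (f1 n)|exact: f_C].
have c1' : (fun n => 2 * (`|\int[leb]_(x in Omega) (w x * f_ n x)| - C ^+ 2)) @ \oo -->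
    2 * (`|\int[leb]_(x in Omega) (w x * f x)| - C ^+ 2).
  apply: cvgM; first exact: cvg_cst.
  by apply: cvgB; [exact: cvg_norm c1|exact: cvg_cst].
by have := cvg_le_limn_einf c1' le_n; rewrite limn_einf_cst.
Qed.

End weak_derivative_bound.

(** * The energy estimate *)

Section energy_estimate.
Context (R : realType) (T : R) (T0 : 0 < T).
Local Notation leb := (@lebesgue_measure R).
Local Notation meas := {measure set (measurableTypeR R) -> \bar R}.
Local Notation D := (`[0, T]%classic : set (measurableTypeR R)).
Implicit Types (f h : R -> R) (x t M Q : R).
Context (pi_ : R -> meas) (pi_cadlag : cadlag T M0set pi_).

Let mD : measurable D. Proof. exact: measurable_itv. Qed.
Let mO : measurable (Omega : set (measurableTypeR R)). Proof. exact: measurable_Omega. Qed.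
Let n11 : (-1 : R) < 1. Proof. lra. Qed.

Lemma lebesgue_itv0T_lty : (leb D < +oo)%E.
Proof.
by rewrite lebesgue_measure_itv/=; case: ifPn => _; rewrite ?ltry// -EFinD ltry.
Qed.

Lemma cell_dbump_bounded n i j : exists M, forall x : R, Omega x -> `|cell_dbump n i j x| <= M.
Proof.
have [M MP] : exists M, forall x : R, x \in `[-1, 1] -> `|cell_dbump n i j x| <= M.
  by apply: within_continuous_bounded; apply: continuous_subspaceT; exact: dbump_cont.
by exists M => x Ox; apply: MP; exact: subset_itv_oo_cc.
Qed.

Let q n j i t := pairing (pi_ t) (cell_dbump n i j).

Let q_measurable n j i : measurable_fun D (q n j i).
Proof.
apply: (measurable_pairing T0 pi_cadlag); last exact: cell_dbump_bounded.
by apply: continuous_subspaceT; exact: dbump_cont.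
Qed.

Let q_bounded n j i : exists M, forall t, D t -> `|q n j i t| <= M.
Proof.
have [M MP] := cell_dbump_bounded n i j; exists (2 * `|M|) => t Dt.
have [M0 _ _] := pi_cadlag; have [Mt _] := M0 t Dt.
apply: pairing_bounded => //.
by apply: within_continuous_measurable; apply: continuous_subspaceT; exact: dbump_cont.
Qed.

Let q_density n j i t : D t ->
  \int[leb]_(x in Omega) (density (pi_ t) x * cell_dbump n i j x) = q n j i t.
Proof.
move=> Dt; have [M0 _ _] := pi_cadlag; have [Mt _] := M0 t Dt.
rewrite /q (pairing_density Mt (densityP pi_cadlag Dt))//; exact: dbump_cont.
Qed.

Lemma cell_bump_neq0 n i j x : cell_bump n i j x != 0 -> cell (-1) 1 n i x.
Proof.
move=> /(bump_support (ltr_nodeS _ n i)); rewrite /cell/= in_itv/=.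
have : 0 < (j.+1%:R * (node (-1) 1 n i.+1 - node (-1) 1 n i))^-1 :> R.
  by rewrite invr_gt0 mulr_gt0// subr_gt0 ltr_nodeS.
set e := (_)^-1 => e0; clearbody e; lra.
Qed.

Let integral_cell_le n i : 0 <= \int[leb]_(x in Omega) \1_(cell (-1) 1 n i) x <= mesh (-1 : R) 1 n.
Proof.
have mc : measurable (cell (-1) 1 n i : set (measurableTypeR R)) by exact: measurable_cell.
have lc : leb (cell (-1) 1 n i) = (mesh (-1 : R) 1 n)%:E.
  by rewrite lebesgue_measure_itv/= lte_fin ltr_nodeS -EFinD nodeS addrC addKr.
rewrite /Rintegral integral_indic//.
have le1 : (leb (cell (-1) 1 n i `&` Omega) <= (mesh (-1 : R) 1 n)%:E)%E.
  by rewrite -lc; apply: le_measure; rewrite ?inE//; exact: measurableI.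
have fin : leb (cell (-1) 1 n i `&` Omega) \is a fin_num.
  by rewrite ge0_fin_numE// (le_lt_trans le1)// ltry.
by rewrite fine_ge0//= -lee_fin fineK.
Qed.

(** The energy tested on [sum_i H_i(t) phi_i(x)].  The bumps have disjoint supports
    and [chi <= 1], so the quadratic term is at most [d * sum_i H_i(t)^2]. *)
Let energy_C1 Q n j (H : nat -> R -> R) : (energy T pi_ <= Q%:E)%E ->
    (forall i, C1 0 T (H i)) ->
  \int[leb]_(t in D) \sum_(i < n.+1) (2 * (H i t * q n j i t) - mesh (-1) 1 n * H i t ^+ 2) <= Q.
Proof.
move=> EQ H1.
have d0 : 0 < mesh (-1 : R) 1 n by exact: mesh_gt0.
set d := mesh _ _ _ in d0 *.
pose e := (j.+1%:R * d)^-1.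
have e0 : 0 < e by rewrite invr_gt0 mulr_gt0.
have [] := @C12c_sum R T n.+1 H (fun i => cell_bump n i j) (fun i => cell_dbump n i j)
  (fun i => ddbump (node (-1) 1 n i) (node (-1) 1 n i.+1) j) (-1 + e) (1 - e) T0.
- by clearbody e; lra.
- by clearbody e; lra.
- exact: H1.
- by move=> i x; exact: is_derive_bump.
- by move=> i x; exact: is_derive_dbump.
- by move=> i; exact: ddbump_cont.
- move=> i x ni /(bump_support (ltr_nodeS _ n i)).
  rewrite [in X in X -> _]nodeS [_ + _ - _]addrC addKr -/d -/e.
  have /andP[l1 _] := node_itv R (ltnW ni); have /andP[_ r1] := node_itv R ni.
  rewrite -nodeS => /andP[xl xr]; clearbody e; apply/andP; split; lra.
set G := fun t x => _; move=> GC dxG.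
have : ((2 * (\int[leb]_(t in D) \int[leb]_(x in Omega) (density (pi_ t) x * dx G t x))
     - \int[leb]_(t in D) \int[leb]_(x in Omega) (chi (density (pi_ t) x) * G t x ^+ 2))%:E <= Q%:E)%E.
  by apply: le_trans EQ; apply: ereal_sup_ubound; exists G.
rewrite lee_fin; apply: le_trans.
have mH i : measurable_fun D (H i).
  by have [Hc _ _] := H1 i; exact: subspace_continuous_measurable_fun.
have bH i : exists M, forall t, D t -> `|H i t| <= M.
  by have [Hc _ _] := H1 i; exact: within_continuous_bounded.
have iHq i : leb.-integrable D (EFin \o (fun t => H i t * q n j i t)).
  have [M1 HM] := bH i; have [M2 qM] := q_bounded n j i.
  apply: (@bounded_integrable _ _ _ _ (M1 * M2)) => //.
  - exact: lebesgue_itv0T_lty.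
  - exact: measurable_funM.
  - by move=> t Dt; rewrite normrM ler_pM//; [exact: HM|exact: qM].
have iH2 i : leb.-integrable D (EFin \o (fun t => H i t ^+ 2)).
  have [M1 HM] := bH i.
  apply: (@bounded_integrable _ _ _ _ (M1 ^+ 2)) => //.
  - exact: lebesgue_itv0T_lty.
  - exact: measurable_funX.
  - by move=> t Dt; rewrite normrX lerXn2r ?nnegrE// ?(le_trans _ (HM t Dt))//; exact: HM.
have inner1 t : D t -> \int[leb]_(x in Omega) (density (pi_ t) x * dx G t x) =
    \sum_(i < n.+1) H i t * q n j i t.
  move=> Dt; have iu := integrable_density (densityP pi_cadlag Dt).
  have iuc (i : 'I_n.+1) : leb.-integrable Omega
      (EFin \o (fun x => density (pi_ t) x * cell_dbump n i j x)).
    have [M MP] := cell_dbump_bounded n i j.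
    apply: (@integrable_mul_bounded _ _ _ _ M); [exact: mO|exact: iu| |exact: MP].
    by apply: within_continuous_measurable; apply: continuous_subspaceT; exact: dbump_cont.
  transitivity (\int[leb]_(x in Omega) \sum_(i < n.+1)
      H i t * (density (pi_ t) x * cell_dbump n i j x)).
    apply: eq_Rintegral => x _; rewrite dxG mulr_sumr.
    by apply: eq_bigr => i _; rewrite mulrCA.
  rewrite (Rintegral_sum _ mO (fun i : 'I_n.+1 => integrable_scale (H i t) mO (iuc i))).2.
  by apply: eq_bigr => i _; rewrite RintegralZl// q_density.
have inner2 t : D t -> `|\int[leb]_(x in Omega) (chi (density (pi_ t) x) * G t x ^+ 2)| <=
    \sum_(i < n.+1) d * H i t ^+ 2.
  move=> Dt; have [mu_ u01 _] := densityP pi_cadlag Dt.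
  have icell i : leb.-integrable Omega (EFin \o (\1_(cell (-1) 1 n i) : R -> R)).
    apply: (@bounded_integrable _ _ _ _ 1); [exact: mO|exact: lebesgue_Omega_lty| |].
      by apply: measurable_indic; exact: measurable_cell.
    by move=> x _; rewrite indicE; case: (_ \in _); rewrite ?normr1 ?normr0.
  have [isum sumE] := Rintegral_sum (index_enum 'I_n.+1) mO
    (fun i : 'I_n.+1 => integrable_scale (H i t ^+ 2) mO (icell i)).
  apply: (@le_trans _ _ (\int[leb]_(x in Omega) \sum_(i < n.+1) (H i t ^+ 2 * \1_(cell (-1) 1 n i) x))).
    apply: normr_Rintegral_le_ae => //.
    apply: leb_ae_sub u01 => x u01 Ox; have /andP[u0 u1] := u01 Ox.
    have [i xi] := cell_cover n n11 (subset_itv_oo_co Ox).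
    rewrite (bigD1 i)//= indicE mem_set// mulr1 big1 ?addr0; last first.
      move=> k ki; rewrite indicE memNset ?mulr0// => xk.
      by move/eqP: ki; apply; apply/val_inj; exact: cell_disjoint xk xi.
    have -> : G t x = H i t * cell_bump n i j x.
      rewrite /G (bigD1 i)//= big1 ?addr0// => k ki.
      have [->|/cell_bump_neq0 xk] := eqVneq (cell_bump n k j x) 0; first by rewrite mulr0.
      by exfalso; move/eqP: ki; apply; apply/val_inj; exact: cell_disjoint xk xi.
    have /andP[b0 b1] := bump_itv (node (-1) 1 n i) (node (-1) 1 n i.+1) j x.
    rewrite -/(cell_bump n i j x) in b0 b1.
    have c0 : 0 <= chi (density (pi_ t) x) <= 1.
      by rewrite /chi; move: (density _ _) u0 u1 => r r0 r1; nra.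
    move: c0 => /andP[c0 c1].
    rewrite ger0_norm; last by rewrite mulr_ge0// sqr_ge0.
    rewrite exprMn -[leRHS]mul1r; apply: ler_pM => //.
      by rewrite mulr_ge0// sqr_ge0.
    rewrite -[leRHS]mulr1; apply: ler_wpM2l; first exact: sqr_ge0.
    by rewrite expr2; nra.
  rewrite sumE; apply: ler_sum => i _.
  rewrite RintegralZl// mulrC; apply: ler_wpM2r; first exact: sqr_ge0.
  by have /andP[] := integral_cell_le n i.
have [isH2 sumH2] := Rintegral_sum (index_enum 'I_n.+1) mD
    (fun i : 'I_n.+1 => integrable_scale d mD (iH2 i)).
have [isHq sumHq] := Rintegral_sum (index_enum 'I_n.+1) mD (fun i : 'I_n.+1 => iHq i).
have outer2 : `|\int[leb]_(t in D) \int[leb]_(x in Omega) (chi (density (pi_ t) x) * G t x ^+ 2)| <=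
    \int[leb]_(t in D) \sum_(i < n.+1) d * H i t ^+ 2.
  by apply: normr_Rintegral_le_ae => //; apply: aeW => t; exact: inner2.
have outer1 : \int[leb]_(t in D) \int[leb]_(x in Omega) (density (pi_ t) x * dx G t x) =
    \int[leb]_(t in D) \sum_(i < n.+1) H i t * q n j i t.
  by apply: eq_Rintegral => t /set_mem; exact: inner1.
have -> : \int[leb]_(t in D) \sum_(i < n.+1) (2 * (H i t * q n j i t) - d * H i t ^+ 2) =
    2 * (\int[leb]_(t in D) \sum_(i < n.+1) H i t * q n j i t) -
    \int[leb]_(t in D) \sum_(i < n.+1) d * H i t ^+ 2.
  rewrite -RintegralZl// -RintegralB//; last exact: integrable_scale.
  by apply: eq_Rintegral => t _; rewrite mulr_sumr -sumrB.
rewrite outer1 lerD2l lerN2; apply: le_trans outer2; exact: ler_norm.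
Qed.

Let discrete_measurable n j :
  measurable_fun D (fun t => discrete_energy (pairing (pi_ t)) n j).
Proof.
rewrite /discrete_energy; apply: measurable_sum => i.
apply: measurable_funM; last exact: measurable_cst.
by apply: measurable_funX; exact: q_measurable.
Qed.

(** Optimize [energy_C1] over the [H i]: the optimal [q i / d] is only bounded and
    measurable in time, and is approached by C^1 functions. *)
Let discrete_energy_le Q n j : (energy T pi_ <= Q%:E)%E ->
  leb.-integrable D (EFin \o (fun t => discrete_energy (pairing (pi_ t)) n j)) /\
  \int[leb]_(t in D) discrete_energy (pairing (pi_ t)) n j <= Q.
Proof.
move=> EQ; have d0 : 0 < mesh (-1 : R) 1 n by exact: mesh_gt0.
set d := mesh _ _ _ in d0 *.
have /choice[M qM] := q_bounded n j.
have M0 i : 0 <= M i.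
  have D0 : D 0 by rewrite /= in_itv/= lexx ltW.
  exact: le_trans (normr_ge0 _) (qM i 0 D0).
pose qd i := (fun t => q n j i t / d) \_ D.
have mqd i : measurable_fun setT (qd i).
  apply/(measurable_restrictT _ _).1 => //.
  by apply: measurable_funM; [exact: q_measurable|exact: measurable_cst].
have qdM i t : `|qd i t| <= M i / d.
  rewrite /qd patchE; case: ifPn => [/set_mem Dt|_].
    by rewrite normrM [`|d^-1|]gtr0_norm ?invr_gt0// ler_pM2r ?invr_gt0//; exact: qM.
  by rewrite normr0 divr_ge0// ltW.
have /choice[H HP] : forall i, exists H_ : nat -> R -> R, [/\ forall m, C1 0 T (H_ m),
    forall m x, x \in `[0, T] -> `|H_ m x| <= M i / d &
    \forall x \ae leb, x \in `[0, T] -> H_ ^~ x @ \oo --> qd i x].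
  by move=> i; exact: (C1_approximation 0 T (mqd i) (qdM i)).
have H1 i m : C1 0 T (H i m) by have [] := HP i.
have HM i m t : D t -> `|H i m t| <= M i / d by have [_ + _] := HP i; exact.
have mH i m : measurable_fun D (H i m).
  by have [Hc _ _] := H1 i m; exact: subspace_continuous_measurable_fun.
have Hcvg : \forall t \ae leb, forall i, D t -> (fun m => H i m t) @ \oo --> q n j i t / d.
  apply/ae_foralln => i; have [_ _] := HP i; apply: leb_ae_sub => t ht Dt.
  by have := ht Dt; rewrite /qd patchE mem_set.
have [iN cN] : leb.-integrable D (EFin \o (fun t => discrete_energy (pairing (pi_ t)) n j)) /\
    (fun m => \int[leb]_(t in D) \sum_(i < n.+1)
      (2 * (H i m t * q n j i t) - d * H i m t ^+ 2)) @ \oo -->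
    \int[leb]_(t in D) discrete_energy (pairing (pi_ t)) n j.
  apply: (@Rdominated_cvg _ _ _ leb D
    (fun m t => \sum_(i < n.+1) (2 * (H i m t * q n j i t) - d * H i m t ^+ 2))
    (fun t => discrete_energy (pairing (pi_ t)) n j)
    (cst (\sum_(i < n.+1) (2 * (M i / d * M i) + d * (M i / d) ^+ 2)))) => //.
  - move=> m; apply: measurable_sum => i; apply: measurable_funB.
      apply: measurable_funM; first exact: measurable_cst.
      by apply: measurable_funM; [exact: mH|exact: q_measurable].
    apply: measurable_funM; first exact: measurable_cst.
    by apply: measurable_funX; exact: mH.
  - apply: leb_ae_sub Hcvg => t ht Dt.
    rewrite /discrete_energy; apply: (@cvg_sumr _ _ _ (fun (i : 'I_n.+1) m =>
      2 * (H i m t * q n j i t) - d * H i m t ^+ 2)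
      (fun i : 'I_n.+1 => q n j i t ^+ 2 / d)) => i.
    have -> : q n j i t ^+ 2 / d = 2 * (q n j i t / d * q n j i t) - d * ((q n j i t / d) * (q n j i t / d)).
      by field; exact: lt0r_neq0.
    have hi := ht i Dt.
    under eq_fun do rewrite expr2.
    apply: cvgB.
      apply: cvgM; first exact: cvg_cst.
      by apply: cvgM; [exact: hi|exact: cvg_cst].
    apply: cvgM; first exact: cvg_cst.
    by apply: cvgM; exact: hi.
  - apply: (@bounded_integrable _ _ _ _ `|\sum_(i < n.+1) (2 * (M i / d * M i) + d * (M i / d) ^+ 2)|) => //.
    exact: lebesgue_itv0T_lty.
  - apply: aeW => t Dt m; apply: le_trans (ler_norm_sum _ _ _) _.
    apply: ler_sum => i _; apply: le_trans (ler_normB _ _) _.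
    have -> : `|2 * (H i m t * q n j i t)| = 2 * (`|H i m t| * `|q n j i t|).
      by rewrite !normrM ger0_norm.
    have -> : `|d * H i m t ^+ 2| = d * `|H i m t| ^+ 2.
      by rewrite normrM normrX gtr0_norm.
    have h1 := HM i m t Dt; have h2 := qM i t Dt.
    apply: lerD.
      by rewrite ler_pM2l//; apply: ler_pM.
    by rewrite ler_pM2l//; apply: lerXn2r; rewrite ?nnegrE// divr_ge0// ltW.
split => //.
apply: (ler_cvg_to cN (cvg_cst Q)); apply: nearW => m.
exact: (@energy_C1 Q n j (fun i => H i m)).
Qed.

Let relaxed_ge0 t : (0 <= relaxed_energy (pairing (pi_ t)))%E.
Proof.
rewrite -(limn_einf_cst 0%E); apply: le_limn_einf => n.
rewrite -(limn_einf_cst 0%E); apply: le_limn_einf => j.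
rewrite lee_fin; apply: sumr_ge0 => i _; rewrite divr_ge0 ?sqr_ge0//.
by rewrite ltW// mesh_gt0.
Qed.

(** Fatou's lemma, once for the bumps and once for the mesh. *)
Lemma relaxed_energy_dominated Q : (energy T pi_ <= Q%:E)%E ->
  exists K : R -> R, [/\ leb.-integrable D (EFin \o K), forall t, 0 <= K t &
    \forall t \ae leb, D t -> (relaxed_energy (pairing (pi_ t)) <= (K t)%:E)%E].
Proof.
move=> EQ.
pose E n t := limn_einf (fun j => (discrete_energy (pairing (pi_ t)) n j)%:E).
have N0 n j t : (0 <= (discrete_energy (pairing (pi_ t)) n j)%:E)%E.
  rewrite lee_fin; apply: sumr_ge0 => i _; rewrite divr_ge0 ?sqr_ge0//.
  by rewrite ltW// mesh_gt0.
have mN n j : measurable_fun D (fun t => (discrete_energy (pairing (pi_ t)) n j)%:E).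
  by apply/measurable_EFinP; exact: discrete_measurable.
have mE n : measurable_fun D (E n) by exact: measurable_limn_einf.
have E0 n t : (0 <= E n t)%E.
  by rewrite -(limn_einf_cst 0%E); exact: le_limn_einf.
have EnQ n : (\int[leb]_(t in D) E n t <= Q%:E)%E.
  apply: le_trans (fatou leb mD (mN n) (fun j t _ => N0 n j t)) _.
  rewrite -(limn_einf_cst Q%:E); apply: le_limn_einf => j.
  have [iN NQ] := discrete_energy_le n j EQ.
  by rewrite -(fineK (integrable_fin_num mD iN)) lee_fin.
have EQ' : (\int[leb]_(t in D) relaxed_energy (pairing (pi_ t)) <= Q%:E)%E.
  apply: le_trans (fatou leb mD mE (fun n t _ => E0 n t)) _.
  by rewrite -(limn_einf_cst Q%:E); exact: le_limn_einf.
have mR : measurable_fun D (fun t => relaxed_energy (pairing (pi_ t))).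
  exact: measurable_limn_einf.
have iR : leb.-integrable D (fun t => relaxed_energy (pairing (pi_ t))).
  apply/integrableP; split => //.
  under eq_integral do rewrite gee0_abs//.
  by apply: le_lt_trans EQ' _; rewrite ltry.
exists (fun t => fine (relaxed_energy (pairing (pi_ t)))); split.
- apply: le_integrable iR => //.
    apply/measurable_EFinP.
    exact: (measurableT_comp (@measurable_fun_fine R)).
  move=> t _ /=; case: (relaxed_energy _) (relaxed_ge0 t) => [r| |]//= _.
  by rewrite leey.
- by move=> t; exact: fine_ge0.
- apply: leb_ae_sub (integrable_ae mD iR) => t fin Dt.
  by rewrite fineK//; exact: fin.
Qed.

End energy_estimate.

(** * Boundary terms *)

Section boundary_terms.
Context (R : realType).
Local Notation leb := (@lebesgue_measure R).
Implicit Types (u v : R -> R) (x y h M : R).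

(** The complement of a null set is dense. *)
Lemma continuous_ae_itv v : {within `[-1, 1], continuous v} ->
    (\forall x \ae leb, Omega x -> 0 <= v x <= 1) ->
  forall x, x \in `[-1, 1] -> 0 <= v x <= 1.
Proof.
move=> /subspace_continuousP vc [N [mN N0 sub]] x x11.
have near01 e : 0 < e -> exists2 y, 0 <= v y <= 1 & `|v x - v y| <= e.
  move=> e0; have /cvgrPdist_le/(_ _ e0) := vc x x11.
  rewrite near_withinE => -[d /= d0 dP].
  pose l := Num.max (-1) (x - d); pose r := Num.min 1 (x + d).
  have lr : l < r.
    move: x11; rewrite in_itv/= /l /r => /andP[x1 x2].
    by rewrite lt_min !gt_max; apply/andP; split; apply/andP; split; lra.
  have [y yJ y01] : exists2 y, y \in `]l, r[ & 0 <= v y <= 1.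
    apply: contrapT => noy.
    have JN : `]l, r[%classic `<=` N.
      move=> y yJ; apply: sub => /= yP; apply: noy; exists y => //; apply: yP.
      move: yJ; rewrite /Omega/= !in_itv/= /l /r lt_min gt_max.
      by move=> /andP[/andP[-> _] /andP[-> _]].
    have : (leb `]l, r[ <= 0)%E.
      by rewrite -N0; apply: le_measure; rewrite ?inE//; exact: measurable_itv.
    rewrite lebesgue_measure_itv/= lte_fin lr -EFinD lee_fin; lra.
  exists y => //; apply: dP => /=.
    move: yJ; rewrite in_itv/= /l /r lt_min gt_max ltr_norml.
    by move=> /andP[/andP[_ ?] /andP[_ ?]]; apply/andP; split; lra.
  move: yJ; rewrite !in_itv/= /l /r lt_min gt_max.
  by move=> /andP[/andP[? _] /andP[? _]]; apply/andP; split; lra.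
apply/andP; split; apply/ler_addgt0Pr => e e0.
- have [y /andP[y0 y1]] := near01 e e0; rewrite ler_norml => /andP[]; lra.
- have [y /andP[y0 y1]] := near01 e e0; rewrite ler_norml => /andP[]; lra.
Qed.

Lemma cont_version_itv u : (\forall x \ae leb, Omega x -> 0 <= u x <= 1) ->
  forall x, x \in `[-1, 1] -> 0 <= cont_version u x <= 1.
Proof.
move=> u01; rewrite /cont_version; case: xgetP => [v _ [vc vu]|_] x x11; last first.
  by rewrite lexx ler01.
apply: continuous_ae_itv vc _ x x11.
by apply: leb_ae_sub (leb_ae_and vu u01) => y [vuy u01y] Oy; rewrite vuy//; exact: u01y.
Qed.

Lemma right_end_itv : (1 : R) \in `[-1, 1].
Proof. by rewrite in_itv/=; apply/andP; split; lra. Qed.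

Lemma left_end_itv : (-1 : R) \in `[-1, 1].
Proof. by rewrite in_itv/=; apply/andP; split; lra. Qed.

Lemma normr_chi_le1 x : 0 <= x <= 1 -> `|chi x| <= 1.
Proof.
move=> /andP[x0 x1]; rewrite /chi ger0_norm; first by nra.
by rewrite mulr_ge0// subr_ge0.
Qed.

Lemma normr_expR_sub1 h : `|expR h - 1| <= `|h| * expR `|h|.
Proof.
have e1 := expR_ge1Dx h; have e0 := expR_gt0 h.
have [h0|h0] := leP 0 h.
  rewrite (ger0_norm h0) ger0_norm; last by have := expR_ge1Dx h; lra.
  have := expR_ge1Dx (- h); rewrite expRN.
  rewrite -(ler_pM2r e0) mulVf ?gt_eqF//; nra.
have hn : `|h| = - h by rewrite ltr0_norm.
have := expR_ge1Dx `|h|; rewrite hn => e2.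
have e3 : expR h <= 1 by rewrite -expR0 ler_expR ltW.
rewrite ler0_norm; [nra|lra].
Qed.

(** [|e^h - 1| <= |h| e^|h|] makes the exponential terms linear in [h] on bounded
    sets. *)
Lemma normr_B_le (fa fb up um hp hm M : R) : 0 < fa < 1 -> 0 < fb < 1 ->
    0 <= up <= 1 -> 0 <= um <= 1 -> `|hp| <= M -> `|hm| <= M ->
  `|B fa fb up um hp hm| <= 2 * expR M * (`|hp| + `|hm|).
Proof.
move=> /andP[a0 a1] /andP[b0 b1] /andP[p0 p1] /andP[m0 m1] hpM hmM.
have bnd c y : 0 <= c <= 1 -> `|y| <= M -> `|c * (expR y - 1)| <= expR M * `|y|.
  move=> /andP[c0 c1] yM; rewrite normrM (ger0_norm c0).
  apply: (@le_trans _ _ (`|y| * expR `|y|)).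
    by apply: le_trans (normr_expR_sub1 y); rewrite ler_piMl.
  by rewrite mulrC; apply: ler_wpM2r; rewrite // ler_expR.
have t1 : `|up * (1 - fb) * (expR (- hp) - 1)| <= expR M * `|hp|.
  by rewrite -(normrN hp); apply: bnd; rewrite ?normrN//; apply/andP; split; nra.
have t2 : `|fb * (1 - up) * (expR hp - 1)| <= expR M * `|hp|.
  by apply: bnd => //; apply/andP; split; nra.
have t3 : `|um * (1 - fa) * (expR (- hm) - 1)| <= expR M * `|hm|.
  by rewrite -(normrN hm); apply: bnd; rewrite ?normrN//; apply/andP; split; nra.
have t4 : `|fa * (1 - um) * (expR hm - 1)| <= expR M * `|hm|.
  by apply: bnd => //; apply/andP; split; nra.
rewrite /B; apply: le_trans (ler_normD _ _) _.
have := ler_normD (up * (1 - fb) * (expR (- hp) - 1) + fb * (1 - up) * (expR hp - 1))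
  (um * (1 - fa) * (expR (- hm) - 1)).
have := ler_normD (up * (1 - fb) * (expR (- hp) - 1)) (fb * (1 - up) * (expR hp - 1)).
lra.
Qed.

End boundary_terms.

(** * Bounding the time derivative of the pairing *)

Section clamped_bound.
Context (R : realType).
Local Notation leb := (@lebesgue_measure R).

(** Clamp [f] to the interval from [- C] to [C]. *)
Lemma weak_deriv_bound_ae (u w f : R -> R) (C : R) : 0 <= C -> is_weak_deriv u w ->
    measurable_fun Omega f -> (\forall x \ae leb, Omega x -> `|f x| <= C) ->
  ((2 * (`|\int[leb]_(x in Omega) (w x * f x)| - C ^+ 2))%:E <=
    relaxed_energy (fun h => \int[leb]_(x in Omega) (u x * h x))%R)%E.
Proof.
move=> C0 wd mf fC; have mO := @measurable_Omega R; have [mw _ _] := wd.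
pose fc x := Num.max (- C) (Num.min C (f x)).
have mfc : measurable_fun Omega fc.
  apply: measurable_maxr; first exact: measurable_cst.
  by apply: measurable_minr; first exact: measurable_cst.
have fcC x : Omega x -> `|fc x| <= C.
  by move=> _; rewrite /fc ler_norml le_max lexx/= ge_max ge_min lexx/= andbT; lra.
have -> : \int[leb]_(x in Omega) (w x * f x) = \int[leb]_(x in Omega) (w x * fc x).
  congr fine; apply: ae_eq_integral => //.
  - by apply/measurable_EFinP; exact: measurable_funM.
  - by apply/measurable_EFinP; exact: measurable_funM.
  - apply: leb_ae_sub fC => x fC Ox; have := fC Ox; rewrite ler_norml => /andP[f1 f2].
    by rewrite /fc (min_idPr f2) (max_idPr f1).
exact: weak_deriv_bound.
Qed.

Lemma weak_deriv_spec (u : R -> R) :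
  is_weak_deriv u (weak_deriv u) \/ weak_deriv u = (fun=> 0).
Proof. by rewrite /weak_deriv; case: xgetP => [w _ ?|_]; [left|right]. Qed.

End clamped_bound.

Section rate_bound.
Context (R : realType) (a fa fb T : R) (hfa : 0 < fa < 1) (hfb : 0 < fb < 1) (T0 : 0 < T).
Local Notation leb := (@lebesgue_measure R).
Local Notation meas := {measure set (measurableTypeR R) -> \bar R}.
Local Notation D := (`[0, T]%classic : set (measurableTypeR R)).
Context (pi_ : R -> meas) (g : R -> R).
Context (hpi : cadlag T Mset pi_) (hI : (rate a fa fb T pi_ < +oo)%E) (hg : C1 (-1) 1 g).
Implicit Types (x t M c : R).

Let mD : measurable D. Proof. exact: measurable_itv. Qed.
Let mO : measurable (Omega : set (measurableTypeR R)). Proof. exact: measurable_Omega. Qed.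

Let F t := pairing (pi_ t) g.

Let ell (H : R -> R) : R :=
  H T * F T - H 0 * F 0 - \int[leb]_(t in D) (derive1 H t * F t).

(** Outside [DE] every [J] is infinite, so a finite rate forces finite energy. *)
Lemma rate_finite_bound : exists2 I0 : R, DE T pi_ &
  forall H, C11 T H -> J_formula a fa fb T H pi_ <= I0.
Proof.
have C0 : C11 T (fun _ _ : R => 0 : R).
  have := C11_mul (C1_cst 0 T 0) (C1_cst (-1) 1 0).
  by under [X in C11 _ X]eq_fun do under eq_fun do rewrite mul0r.
have Jrate H : C11 T H -> (J a fa fb T H pi_ <= rate a fa fb T pi_)%E.
  by move=> H11; apply: ereal_sup_ubound; exists H.
have dE : DE T pi_.
  apply: contrapT => nDE; have := Jrate _ C0; rewrite /J asboolF//.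
  by rewrite leye_eq => /eqP rE; move: hI; rewrite rE ltxx.
have JE H : J a fa fb T H pi_ = (J_formula a fa fb T H pi_)%:E.
  by rewrite /J asboolT.
move: hI Jrate; case: (rate _ _ _ _ _) => [r _ Jr|//|_ Jr].
  exists r => // H H11; rewrite -lee_fin -JE; exact: Jr.
by have := Jr _ C0; rewrite JE.
Qed.

Let g_bounded : exists2 c, 0 <= c & forall x, x \in `[-1, 1] -> `|g x| <= c.
Proof.
have [gc _ _] := hg; have [c cP] := within_continuous_bounded gc.
by exists `|c| => // x x11; apply: le_trans (cP x x11) (ler_norm _).
Qed.

Let dg_bounded : exists2 c, 0 <= c & forall x, Omega x -> `|derive1 g x| <= c.
Proof.
have [_ _ [h hc dgE]] := hg; have [c cP] := within_continuous_bounded hc.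
exists `|c| => // x Ox; rewrite dgE//; apply: le_trans (cP x _) (ler_norm _).
exact: subset_itv_oo_cc.
Qed.

Let g_measurable : measurable_fun (Omega : set (measurableTypeR R)) g.
Proof. by apply: within_continuous_measurable; case: hg. Qed.

Let dg_measurable : measurable_fun (Omega : set (measurableTypeR R)) (derive1 g).
Proof.
have [_ _ [h hc dgE]] := hg.
apply: (eq_measurable_fun h); first by move=> x /set_mem Ox; rewrite dgE.
exact: within_continuous_measurable.
Qed.

Let F_measurable : measurable_fun D F.
Proof.
have [gc _ _] := hg; have [c c0 cP] := g_bounded.
apply: (measurable_pairing T0 hpi).
  by apply: continuous_subspaceW gc => x; exact: subset_itv_oo_cc.
by exists c => x Ox; apply: cP; exact: subset_itv_oo_cc.
Qed.

Let F_bounded : exists2 c, 0 <= c & forall t, D t -> `|F t| <= c.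
Proof.
have [c c0 cP] := g_bounded; exists (2 * `|c|) => [|t Dt]; first by rewrite mulr_ge0.
have [M0 _ _] := hpi; apply: pairing_bounded => //; first exact: M0.
by move=> x Ox; apply: cP; exact: subset_itv_oo_cc.
Qed.

Let pairing_scale t c : D t -> pairing (pi_ t) (fun x => c * g x) = c * F t.
Proof.
move=> Dt; have [c' c0 cP] := g_bounded; have [M0 _ _] := hpi; have [_ m2] := M0 t Dt.
apply: RintegralZl => //; apply: (@bounded_integrable _ _ _ _ c') => //.
  by apply: le_lt_trans m2 (ltry _).
by move=> x Ox; apply: cP; exact: subset_itv_oo_cc.
Qed.

(** At the endpoints of [0,T] the derivative of a C^1 function takes an unspecified
    value. *)
Let eq_inner_integral (f h : R -> R) : leb.-integrable D (EFin \o h) ->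
    (forall t, t \in `]0, T[ -> f t = h t) ->
  leb.-integrable D (EFin \o f) /\ \int[leb]_(t in D) f t = \int[leb]_(t in D) h t.
Proof.
move=> ih fh; have mh : measurable_fun D h.
  by case/integrableP : ih => /measurable_EFinP.
have ae : ae_eq leb D (EFin \o h) (EFin \o f).
  apply: leb_ae_sub (leb_ae_and (leb_ae_neq 0) (leb_ae_neq T)) => t [t0 tT] Dt /=.
  rewrite fh//; move: Dt; rewrite /= !in_itv/= => /andP[].
  by rewrite le_eqVlt eq_sym (negbTE t0)/= => ->; rewrite le_eqVlt (negbTE tT).
have mf : measurable_fun D f.
  have -> : D = [set 0] `|` (`]0, T[%classic `|` [set T]).
    rewrite setUitv1; last by rewrite bnd_simp.
    by rewrite setU1itv// bnd_simp ltW.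
  apply/measurable_funU => //; first exact: measurableU.
  split; first exact: measurable_fun_set1.
  apply/measurable_funU => //; split; last exact: measurable_fun_set1.
  apply: (eq_measurable_fun h); first by move=> t /set_mem/fh ->.
  by apply: measurable_funS mh => //; exact: subset_itv_oo_cc.
split.
  have /integrableP[mh' hy] := ih; have mf' : measurable_fun D (EFin \o f).
    exact/measurable_EFinP.
  apply/integrableP; split=> //; apply: le_lt_trans hy.
  apply: ae_ge0_le_integral => //; [exact: measurableT_comp|exact: measurableT_comp|].
  by apply: leb_ae_sub ae => t hft Dt; rewrite (hft Dt).
by congr fine; apply: ae_eq_integral => //; [exact/measurable_EFinP..|exact: ae_eq_sym].
Qed.

Let derive_integrable (H : R -> R) : C1 0 T H ->
  leb.-integrable D (EFin \o (fun t => derive1 H t * F t)).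
Proof.
move=> [_ _ [h hc HE]].
have [c1 c1P] := within_continuous_bounded hc; have [c2 c20 c2P] := F_bounded.
have ih : leb.-integrable D (EFin \o (fun t => h t * F t)).
  apply: (@bounded_integrable _ _ _ _ (c1 * c2)) => //.
  - exact: lebesgue_itv0T_lty.
  - apply: measurable_funM; last exact: F_measurable.
    exact: subspace_continuous_measurable_fun.
  - by move=> t Dt; rewrite normrM; apply: ler_pM => //; [exact: c1P|exact: c2P].
by have [] := @eq_inner_integral (fun t => derive1 H t * F t) _ ih (fun t tT => congr1 ( *%R^~ (F t)) (HE t tT)).
Qed.

Let ell_linear c (f h : R -> R) : C1 0 T f -> C1 0 T h ->
  ell (fun t => c * f t + h t) = c * ell f + ell h.
Proof.
move=> f1 h1; have [_ fd _] := f1; have [_ hd _] := h1.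
have if' := derive_integrable f1; have ih' := derive_integrable h1.
have icf' := integrable_scale c mD if'.
have isum : leb.-integrable D (EFin \o (fun t => c * (derive1 f t * F t) + derive1 h t * F t)).
  exact: (integrableD mD icf' ih').
have [|_ intE] := @eq_inner_integral (fun t => derive1 (fun t => c * f t + h t) t * F t) _ isum.
  move=> t tT; rewrite (derive1_is_derive (is_derive_addr
    (is_derive_scaler c (is_derive1P (fd t tT))) (is_derive1P (hd t tT)))); ring.
rewrite /ell intE (RintegralD mD icf' ih') (RintegralZl c mD if').
move: (Rintegral _ _ _) (Rintegral _ _ _) (F T) (F 0) => X Y FT F0.
by ring.
Qed.

(** If the weak derivative does not exist at time [t], its default value makes the
    integral vanish; otherwise [weak_deriv_bound] applies to the product of the
    diffusivity and [derive1 g]. *)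
Let inner_gradient t (K : R) (C : R) (c : R) : cadlag T M0set pi_ -> D t ->
    0 <= C -> (forall x, 0 <= x <= 1 -> forall y, Omega y -> `|diffusivity a x * derive1 g y| <= C) ->
    (relaxed_energy (pairing (pi_ t)) <= K%:E)%E -> 0 <= K ->
  `|\int[leb]_(x in Omega) (diffusivity a (density (pi_ t) x) * weak_deriv (density (pi_ t)) x *
     (c * derive1 g x))| <= `|c| * (C ^+ 2 + K / 2).
Proof.
move=> hc Dt C0 CP EK K0; have dt' := densityP hc Dt; have [mu_ u01 _] := dt'.
set u := density (pi_ t) in mu_ u01 dt' *; set w := weak_deriv u.
pose f x := diffusivity a (u x) * derive1 g x.
have [wd|w0] : is_weak_deriv u w \/ w = (fun=> 0) := weak_deriv_spec u; last first.
  under eq_Rintegral do rewrite w0 mulr0 mul0r.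
  rewrite Rintegral_cst// mul0r normr0 mulr_ge0// addr_ge0// ?sqr_ge0//.
  by rewrite divr_ge0.
have mf : measurable_fun Omega f.
  apply: measurable_funM; last exact: dg_measurable.
  rewrite /diffusivity; apply: measurable_funD; first exact: measurable_cst.
  by apply: measurable_funM => //; exact: measurable_cst.
have fC : \forall x \ae leb, Omega x -> `|f x| <= C.
  by apply: leb_ae_sub u01 => x u01 Ox; apply: CP => //; exact: u01.
have relE : relaxed_energy (fun h => \int[leb]_(x in Omega) (u x * h x)) =
    relaxed_energy (pairing (pi_ t)).
  rewrite /relaxed_energy; congr limn_einf; apply/funext => n.
  congr limn_einf; apply/funext => j; congr EFin; apply: eq_bigr => i _.
  have [M0 _ _] := hc; have [Mt _] := M0 t Dt.
  by rewrite (pairing_density Mt dt')//; exact: dbump_cont.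
have := weak_deriv_bound_ae C0 wd mf fC; rewrite relE => /le_trans/(_ EK).
rewrite lee_fin => wfK.
clearbody w; clear relE EK; clearbody u.
have iwf : leb.-integrable Omega (EFin \o (fun x => w x * f x)).
  have iw := weak_deriv_integrable wd; have [mw _ _] := wd.
  have iCw := integrable_scale C mO (integrable_norm iw).
  have mwf : measurable_fun Omega (EFin \o (fun x => w x * f x)).
    by apply/measurable_EFinP; exact: measurable_funM.
  have /integrableP[mCw fin] := iCw; apply/integrableP; split; first exact: mwf.
  apply: le_lt_trans fin; apply: (ae_ge0_le_integral mO).
  - by move=> x _; exact: abse_ge0.
  - exact: measurableT_comp.
  - by move=> x _; exact: abse_ge0.
  - exact: measurableT_comp.
  - apply: leb_ae_sub fC => x fC Ox /=; rewrite lee_fin [leRHS]normrM normr_id (ger0_norm C0).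
    by rewrite normrM [leRHS]mulrC; apply: (ler_wpM2l (normr_ge0 _) (fC Ox)).
have -> : \int[leb]_(x in Omega) (diffusivity a (u x) * w x * (c * derive1 g x)) =
    c * \int[leb]_(x in Omega) (w x * f x).
  rewrite -(RintegralZl c mO iwf).
  apply: eq_Rintegral => x _; rewrite /f.
  by rewrite mulrCA -!mulrA; congr (_ * _); rewrite mulrCA.
rewrite normrM; apply: ler_wpM2l; first exact: normr_ge0.
by lra.
Qed.

Let inner_mobility t (C c : R) : cadlag T M0set pi_ -> D t ->
    (forall x, 0 <= x <= 1 -> forall y, Omega y -> `|sigma a x * (c * derive1 g y) ^+ 2| <= C) ->
  `|\int[leb]_(x in Omega) (sigma a (density (pi_ t) x) * (c * derive1 g x) ^+ 2)| <= C * 2.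
Proof.
move=> hc Dt CP; have [_ u01 _] := densityP hc Dt.
apply: (@le_trans _ _ (\int[leb]_(x in Omega) (cst C x))).
  apply: normr_Rintegral_le_ae => //.
    by apply: (@bounded_integrable _ _ _ _ `|C|) => //; exact: lebesgue_Omega_lty.
  by apply: leb_ae_sub u01 => x u01 Ox; apply: CP => //; exact: u01.
have -> : C * 2 = C * fine (leb Omega) by rewrite lebesgue_Omega.
by rewrite Rintegral_cst.
Qed.

(** The last three terms of the rate function are each at most
    [int |H| k_i] when [|H| <= M]. *)
Let ell_bounded : exists I0 : R, forall M, exists k : R -> R,
  [/\ leb.-integrable D (EFin \o k), forall t, D t -> 0 <= k t &
     forall H : R -> R, C1 0 T H -> (forall t, D t -> `|H t| <= M) ->
       ell H <= I0 + \int[leb]_(t in D) (`|H t| * k t)].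
Proof.
have [I0 [hc EQ] JI] := rate_finite_bound; exists I0 => M0.
have {EQ}[Q EQ] : exists Q : R, (energy T pi_ <= Q%:E)%E.
  by move: EQ; case: (energy _ _) => [r _|//|_]; [exists r|exists 0; rewrite leNye].
have [K [iK K0 KP]] := relaxed_energy_dominated T0 hc EQ.
have [cg cg0 cgP] := g_bounded; have [cd cd0 cdP] := dg_bounded.
pose M := `|M0|; have M_ge0 : 0 <= M by exact: normr_ge0.
pose A := 1 + 2 * `|a|.
have A0 : 0 <= A by rewrite /A addr_ge0// mulr_ge0.
have diffA x : 0 <= x <= 1 -> `|diffusivity a x| <= A.
  move=> /andP[x0 x1]; rewrite /diffusivity /A; apply: le_trans (ler_normD _ _) _.
  rewrite normr1 lerD2l !normrM (ger0_norm x0) ger0_norm//.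
  by rewrite -[leRHS]mulr1; apply: ler_wpM2l => //; rewrite mulr_ge0.
(* [c3] bounds the mobility term, 2 being the length of Omega, and [c4] the
   boundary terms, with [cg] bounding [g] at both ends. *)
pose c3 := M * (A * cd ^+ 2 * 2).
pose c4 := 4 * (cg * expR (M * cg)).
have c30 : 0 <= c3 by rewrite !mulr_ge0// sqr_ge0.
have c40 : 0 <= c4 by rewrite !mulr_ge0// expR_ge0.
pose k2 t := (A * cd) ^+ 2 + K t / 2.
have k20 t : 0 <= k2 t by rewrite addr_ge0 ?sqr_ge0// divr_ge0.
have ik2 : leb.-integrable D (EFin \o k2).
  have i1 : leb.-integrable D (EFin \o cst ((A * cd) ^+ 2)).
    apply: (@bounded_integrable _ _ _ _ `|(A * cd) ^+ 2|) => //; exact: lebesgue_itv0T_lty.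
  have := integrableD mD i1 (integrable_scale 2^-1 mD iK); congr integrable.
  by apply/funext => t; rewrite /= /k2 -EFinD [_ / 2]mulrC.
have icst c : leb.-integrable D (EFin \o cst c).
  by apply: (@bounded_integrable _ _ _ _ `|c|) => //; exact: lebesgue_itv0T_lty.
exists (fun t => k2 t + (c3 + c4)); split.
- exact: (integrableD mD ik2 (icst (c3 + c4))).
- by move=> t _; apply: addr_ge0; [exact: k20|exact: addr_ge0].
move=> H H1 HM0.
have HM t : D t -> `|H t| <= M by move=> Dt; apply: le_trans (HM0 t Dt) (ler_norm _).
have [Hc Hd _] := H1.
have mH : measurable_fun D H by exact: subspace_continuous_measurable_fun.
have iH (k : R -> R) : leb.-integrable D (EFin \o k) -> leb.-integrable D (EFin \o (fun t => `|H t| * k t)).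
  move=> ik; have := @integrable_mul_bounded R D k (fun t => `|H t|) M mD ik.
  have -> : (fun t => `|H t| * k t) = (fun t => k t * `|H t|).
    by apply/funext => t; rewrite mulrC.
  apply; first exact: measurableT_comp.
  by move=> t Dt; rewrite normr_id; exact: HM.
have dxG t x : dx (fun t x => H t * g x) t x = H t * derive1 g x \/ ~ Omega x.
  have [Ox|nOx] := pselect (Omega x); [left|by right].
  by have [_ gd _] := hg; exact: derive1_is_derive (is_derive_scaler (H t) (is_derive1P (gd x Ox))).
have dxE t x : Omega x -> dx (fun t x => H t * g x) t x = H t * derive1 g x.
  by case: (dxG t x).
have := JI _ (C11_mul H1 hg); rewrite /J_formula.
set I1 := \int[leb]_(t in D) pairing _ _.
set I2 := \int[leb]_(t in D) _; set I3 := \int[leb]_(t in D) _; set I4 := \int[leb]_(t in D) _.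
have I1E : I1 = \int[leb]_(t in D) (derive1 H t * F t).
  have [|_ //] := @eq_inner_integral (fun t => pairing (pi_ t) (dt (fun t x => H t * g x) t))
    (fun t => derive1 H t * F t) (derive_integrable H1).
  move=> t tT; rewrite -(pairing_scale (derive1 H t) (subset_itv_oo_cc tT)).
  congr pairing; apply/funext => x.
  exact: derive1_is_derive (is_derive_mulr_cst (g x) (is_derive1P (Hd t tT))).
have I2le : `|I2| <= \int[leb]_(t in D) (`|H t| * k2 t).
  apply: normr_Rintegral_le_ae => //; first exact: iH.
  apply: leb_ae_sub KP => t Kt Dt.
  under eq_Rintegral => x /set_mem Ox do rewrite dxE//.
  apply: inner_gradient => //; [by rewrite mulr_ge0| |exact: Kt].
  by move=> x x01 y Oy; rewrite normrM; apply: ler_pM => //; [exact: diffA|exact: cdP].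
have I3le : `|I3| <= \int[leb]_(t in D) (`|H t| * c3).
  apply: normr_Rintegral_le_ae => //; first exact: (iH (cst c3)).
  apply: aeW => t Dt.
  under eq_Rintegral => x /set_mem Ox do rewrite dxE//.
  have -> : `|H t| * c3 = `|H t| * M * (A * cd ^+ 2) * 2 by rewrite /c3; ring.
  apply: inner_mobility => // x x01 y Oy.
  have /andP[x0 x1] := x01.
  have chi1 : `|chi x| <= 1 by exact: normr_chi_le1.
  rewrite /sigma exprMn (normrM (_ * _)) (normrM (chi x)) (normrM (H t ^+ 2)) !normrX.
  apply: (@le_trans _ _ (A * (`|H t| * M * cd ^+ 2))); last by rewrite le_eqVlt; apply/orP; left; apply/eqP; ring.
  apply: ler_pM; rewrite ?mulr_ge0 ?exprn_ge0//.
    by rewrite -[leRHS]mul1r; apply: ler_pM => //; exact: diffA.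
  apply: ler_pM; rewrite ?exprn_ge0//.
    by rewrite expr2; apply: ler_wpM2l => //; exact: HM.
  by apply: lerXn2r; rewrite ?nnegrE//; exact: cdP.
have I4le : `|I4| <= \int[leb]_(t in D) (`|H t| * c4).
  apply: normr_Rintegral_le_ae => //; first exact: (iH (cst c4)).
  apply: aeW => t Dt; have [_ u01 _] := densityP hc Dt.
  have l1 := right_end_itv R; have lN1 := left_end_itv R.
  have hgM y : y \in `[-1, 1] -> `|H t * g y| <= M * cg.
    by move=> y11; rewrite normrM; apply: ler_pM => //; [exact: HM|exact: cgP].
  apply: le_trans (normr_B_le hfa hfb (cont_version_itv u01 l1) (cont_version_itv u01 lN1)
    (hgM _ l1) (hgM _ lN1)) _.
  have hb : `|H t * g 1| + `|H t * g (-1)| <= `|H t| * (2 * cg).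
    rewrite !normrM mulr_natl mulr2n mulrDr; apply: lerD; apply: ler_wpM2l => //; exact: cgP.
  have -> : `|H t| * c4 = 2 * expR (M * cg) * (`|H t| * (2 * cg)) by rewrite /c4; ring.
  by apply: ler_wpM2l => //; rewrite mulr_ge0// expR_ge0.
rewrite [pairing (pi_ T) _](pairing_scale (H T)); last by rewrite /= in_itv/= lexx ltW.
rewrite [pairing (pi_ 0) _](pairing_scale (H 0)); last by rewrite /= in_itv/= lexx ltW.
have -> : \int[leb]_(t in D) (`|H t| * (k2 t + (c3 + c4))) =
    \int[leb]_(t in D) (`|H t| * k2 t) + (\int[leb]_(t in D) (`|H t| * c3) +
    \int[leb]_(t in D) (`|H t| * c4)).
  rewrite -(RintegralD mD (iH _ (icst c3)) (iH _ (icst c4))).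
  rewrite -(RintegralD mD (iH _ ik2) (integrableD mD (iH _ (icst c3)) (iH _ (icst c4)))).
  by apply: eq_Rintegral => t _; rewrite -!mulrDr.
rewrite /ell -I1E.
move: I2le I3le I4le; rewrite !ler_norml.
move: (H T * F T) (H 0 * F 0) I1 I2 I3 I4 {I1E} => X0 X1 X2 X3 X4 X5.
move: (Rintegral _ _ _) (Rintegral _ _ _) (Rintegral _ _ _) => Y2 Y3 Y4.
move=> /andP[b2 _] /andP[_ b3] /andP[_ b4] JI0.
by lra.
Qed.

Lemma weak_time_derivative : exists2 P : R -> R,
    leb.-integrable `[0, T] (EFin \o P) &
    forall H : R -> R, C1 0 T H ->
      H T * pairing (pi_ T) g - H 0 * pairing (pi_ 0) g
      - \int[leb]_(t in `[0, T]) (derive1 H t * pairing (pi_ t) g)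
      = \int[leb]_(t in `[0, T]) (H t * P t).
Proof.
have [I0 bnd] := ell_bounded.
exact: (integral_representation T0 ell_linear bnd).
Qed.

End rate_bound.

Unset Implicit Arguments.

Theorem proposition4p11 (R : realType) (a fa fb : R)
    (ha : - (1 / 2) < a)
    (hfa : 0 < fa < 1) (hfb : 0 < fb < 1) (hab : fa <= fb)
    (T : R) (hT : 0 < T)
    (pi_ : R -> {measure set (measurableTypeR R) -> \bar R})
    (hpi : cadlag T Mset pi_)
    (hI : (rate a fa fb T pi_ < +oo)%E)
    (g : R -> R) (hg : C1 (-1) 1 g) :
  exists2 P : R -> R,
    (@lebesgue_measure R).-integrable `[0, T] (EFin \o P) &
    forall H : R -> R, C1 0 T H ->
      H T * pairing (pi_ T) g - H 0 * pairing (pi_ 0) g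
      - \int[@lebesgue_measure R]_(t in `[0, T]) (derive1 H t * pairing (pi_ t) g)
      = \int[@lebesgue_measure R]_(t in `[0, T]) (H t * P t).
Proof. exact: (@weak_time_derivative R a fa fb T hfa hfb hT pi_ g hpi hI hg). Qed.
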